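(* Let $S$ be a countable (infinite) set with rates $c_{x,y}\in[0,+\infty)$, $x\ne y$ in $S$ (not necessarily symmetric), satisfying Assumption SEP, and let $\mathcal L$ with domain $\mathcal D(\mathcal L)$ be the infinitesimal generator of the simple exclusion process with rates $c_{x,y}$. Let $f\in C(\{0,1\}^S)$ satisfy $\sum_{x\in S}\Delta_f(x)<+\infty$ and $\sum_{x\in S}c^s_x\Delta_f(x)<+\infty$, where $c^s_x:=\sum_{y\in S}c^s_{x,y}$. Then $f\in\mathcal D(\mathcal L)$ and $$\mathcal L f(\eta)=\sum_{x\in S}\sum_{y\in S}c_{x,y}\,\eta(x)\big(1-\eta(y)\big)\big[f(\eta^{x,y})-f(\eta)\big],$$ where the right-hand side is an absolutely convergent series of functions in $C(\{0,1\}^S)$.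
   Context: Setting. $S$ is a countable (infinite) set; $\mathcal E_S^o:=\{(x,y):x\ne y,\ x,y\in S\}$ (ordered pairs), $\mathcal E_S:=\{\{x,y\}:x\neq y,\ x,y\in S\}$ (unordered pairs). To each $(x,y)\in\mathcal E_S^o$ is associated $c_{x,y}\in[0,+\infty)$, not assumed symmetric; $c_{x,x}:=0$; $c^s_{x,y}:=c_{x,y}+c_{y,x}$. Under Assumption SEP below, $c^s_x=\sum_{y\in S}c^s_{x,y}$ is finite for all $x$. Path spaces. For a metric space $W$, $D_W=D(\mathbb R_+,W)$ is the space of càdlàg paths $\mathbb R_+=[0,+\infty)\to W$ with the Skorohod topology and its Borel $\sigma$-algebra. $\mathbb N=\{0,1,\dots\}$ is discrete; $\{0,1\}^S$ has the product topology. $D_{\mathbb N}^{\mathcal E_S^o}$ has the product topology, with generic element $\mathcal K=(\mathcal K_{x,y})_{(x,y)\in\mathcal E_S^o}$. $\mathbb P$ (with expectation $\mathbb E$) is the law on $D_{\mathbb N}^{\mathcal E_S^o}$ of a family $(N_{x,y}(\cdot))_{(x,y)\in\mathcal E_S^o}$ of independent Poisson processes, $N_{x,y}$ having intensity $c_{x,y}$ and $N_{x,y}(0)=0$. For $\{x,y\}\in\mathcal E_S$, $\mathcal K^s_{x,y}(t):=\mathcal K_{x,y}(t)+\mathcal K_{y,x}(t)$. Assumption SEP: there exists $t_0>0$ such that for $\mathbb P$-a.a. $\mathcal K$ the undirected graph $\mathcal G_{t_0}(\mathcal K)$ with vertex set $S$ and edge set $\{\{x,y\}\in\mathcal E_S:\mathcal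 K^s_{x,y}(t_0)>\mathcal K^s_{x,y}(0)\}$ has only connected components of finite cardinality. Such a $t_0$ is fixed. For $r\in\mathbb N$, $\mathcal G^r_{t_0}(\mathcal K)$ is the graph with vertex set $S$ and edge set $\{\{x,y\}\in\mathcal E_S:\mathcal K^s_{x,y}((r+1)t_0)>\mathcal K^s_{x,y}(rt_0)\}$, and $\Gamma_r$ is the set of $\mathcal K$ for which $\mathcal G^r_{t_0}(\mathcal K)$ has only finite connected components. $\Gamma_*$ is the set of $\mathcal K\in D_{\mathbb N}^{\mathcal E_S^o}$ such that: (i) $\mathcal K\in\cap_{r\in\mathbb N}\Gamma_r$; (ii) $\sum_{y\in S\setminus\{x\}}\mathcal K^s_{x,y}(t)<+\infty$ for all $x\in S$, $t\in\mathbb R_+$; (iii) for $(x,y)\ne(x',y')$ in $\mathcal E^o_S$ the sets of jump times of $\mathcal K_{x,y}$ and $\mathcal K_{x',y'}$ are disjoint, and all jumps equal $+1$; (iv) $\mathcal K_{x,y}(0)=0$ for all $(x,y)\in\mathcal E^o_S$. $\Gamma_*$ is Borel and $\mathbb P(\Gamma_* )=1$. Graphical construction. For $\mathcal K\in\Gamma_*$ and $\sigma\in\{0,1\}^S$ define $(\eta^\sigma_t[\mathcal K])_{t\ge0}$ iteratively: $\eta^\sigma_0[\mathcal K]:=\sigma$. If defined up to time $rt_0$, $r\in\mathbb N$, for each (finite) connected component $C$ of $\mathcal G^r_{t_0}(\mathcal K)$ let $s_1<\dots<s_k$ be the times $s\in(rt_0,(r+1)t_0]$ at which $\mathcal K_{x,y}(s)=\mathcal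 K_{x,y}(s-)+1$ for some $x\neq y$ in $C$. On $C$, start from $\eta^\sigma_{rt_0}[\mathcal K]$ and, successively at $s=s_1,\dots,s_k$, move a particle from $x$ to $y$ ($x\ne y$ in $C$) if just before time $s$ site $x$ is occupied and $y$ is empty, and $\mathcal K_{x,y}(s)=\mathcal K_{x,y}(s-)+1$ (at most one such pair exists); between these times the configuration on $C$ is constant. This defines $\eta^\sigma_t[\mathcal K]$ for $t\in(rt_0,(r+1)t_0]$. Semigroup and generator. $C(\{0,1\}^S)$ is the space of real continuous functions with the uniform norm. $S(t)f(\sigma):=\mathbb E[f(\eta^\sigma_t[\mathcal K])]$ defines a strongly continuous Markov semigroup on $C(\{0,1\}^S)$, the semigroup of the simple exclusion process (SEP) with rates $c_{x,y}$. Its generator $\mathcal L$ has domain $\mathcal D(\mathcal L)=\{f\in C(\{0,1\}^S): \lim_{t\downarrow0}(S(t)f-f)/t\text{ exists in }C(\{0,1\}^S)\}$ and $\mathcal L f$ is that limit. $\eta^{x,y}$ is obtained from $\eta$ by exchanging the values at $x$ and $y$. For $f\in C(\{0,1\}^S)$, $\Delta_f(x):=\sup\{|f(\eta)-f(\xi)|:\eta,\xi\in\{0,1\}^S,\ \eta(y)=\xi(y)\ \forall y\in S\setminus\{x\}\}$. Absolutely convergent series in $C(\{0,1\}^S)$: the sum of the uniform norms of the terms is finite. *)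

(* Defs.v *)
From HB Require Import structures.
From mathcomp Require Import all_boot all_order all_algebra.
From mathcomp Require Import finmap.
From mathcomp Require Import all_classical all_reals all_analysis.
From mathcomp.analysis.showcase Require Import summability.

Set Implicit Arguments.
Unset Strict Implicit.
Unset Printing Implicit Defensive.

Import Order.TTheory GRing.Theory Num.Theory.
Import numFieldNormedType.Exports.

Local Open Scope classical_set_scope.
Local Open Scope ring_scope.

Definition cadlag (R : realType) (W : ptopologicalType) (w : R -> W) : Prop :=
  forall t : R, w s @[s --> t^'+] --> w t /\ cvg (w s @[s --> t^'-]).

(** A path on [0, +oo) is encoded by its extension to R that is constant on
    (-oo, 0]. The extension adds neither information nor jumps: the left limit
    at 0 is the value at 0. *)
Record cadlag_path (R : realType) (W : pseudoPMetricType R) := CadlagPath {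
  path_fun :> R -> W ;
  path_neg : forall t, t < 0 -> path_fun t = path_fun 0 ;
  path_cadlag : cadlag path_fun
}.

Definition time_change (R : realType) (lam : R -> R) : Prop :=
  lam @` [set t | 0 <= t] = [set t | 0 <= t] /\
  {in [set t | 0 <= t] &, {homo lam : s t / s < t}}.

(** For a metric space W these sets form a base of neighbourhoods of w in the
    Skorohod (J1) topology (Ethier and Kurtz, Markov Processes, Proposition
    3.5.3 (c)); the neighbourhoods need not be open. *)
Definition skorohod_nbhs (R : realType) (W : pseudoPMetricType R)
    (w : cadlag_path W) (T eps : R) : set (cadlag_path W) :=
  [set v | exists2 lam : R -> R, time_change lam &
     forall t, 0 <= t <= T ->
       `|lam t - t| < eps /\ ball (w (lam t)) eps (v t)].

Definition skorohod_open (R : realType) (W : pseudoPMetricType R) :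
    set (set (cadlag_path W)) :=
  [set U | forall w, U w ->
     exists T eps : R, 0 < eps /\ skorohod_nbhs w T eps `<=` U].

Section skorohod_topology.
Context (R : realType) (W : pseudoPMetricType R).

HB.instance Definition _ := gen_eqMixin (cadlag_path W).
HB.instance Definition _ := gen_choiceMixin (cadlag_path W).

Let cst_path_neg (t : R) : t < 0 -> cst (point : W) t = cst (point : W) (0 : R).
Proof. by []. Qed.

Let cst_path_cadlag : cadlag (cst (point : W) : R -> W).
Proof.
by move=> t; split; [exact: cvg_cst | exact: is_cvg_cst].
Qed.

HB.instance Definition _ := isPointed.Build (cadlag_path W)
  (CadlagPath cst_path_neg cst_path_cadlag).

Let skorohod_openT : skorohod_open (setT : set (cadlag_path W)).
Proof. by move=> w _; exists 0, 1; split. Qed.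

Let skorohod_openI : setI_closed (@skorohod_open R W).
Proof.
move=> U V oU oV w [/oU[T1 [e1 [e1_gt0 sU]]] /oV[T2 [e2 [e2_gt0 sV]]]].
exists (Num.max T1 T2), (Num.min e1 e2); split; first by rewrite lt_min e1_gt0.
move=> v [lam tc wv]; split; [apply: sU | apply: sV]; exists lam => //.
  move=> t /andP[t_ge0 tT].
  have [|] := wv t; first by rewrite t_ge0 le_max tT.
  rewrite lt_min => /andP[-> _] bt; split => //.
  by apply: le_ball bt; rewrite ge_min lexx.
move=> t /andP[t_ge0 tT].
have [|] := wv t; first by rewrite t_ge0 le_max tT orbT.
rewrite lt_min => /andP[_ ->] bt; split => //.
by apply: le_ball bt; rewrite ge_min lexx orbT.
Qed.

Let skorohod_open_bigU (I : Type) (U : I -> set (cadlag_path W)) :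
  (forall i, skorohod_open (U i)) -> skorohod_open (\bigcup_i U i).
Proof.
move=> oU w [i _ /oU[T [e [e_gt0 sU]]]].
by exists T, e; split => // v /sU; exists i.
Qed.

HB.instance Definition _ := isOpenTopological.Build (cadlag_path W)
  skorohod_openT skorohod_openI skorohod_open_bigU.

End skorohod_topology.

Definition borel (T : topologicalType) : set (set T) := <<s @open T >>.

Definition left_lim (R : realType) (w : R -> nat) (s : R) : nat :=
  lim (w u @[u --> s^'-]).

Definition jump_time (R : realType) (w : R -> nat) (s : R) : Prop :=
  w s <> left_lim w s.

Definition increment (R : realType) (w : R -> nat) (s t : R) : int :=
  (w t)%:Z - (w s)%:Z.

Definition independent_increments (R : realType) d (Omega : measurableType d)
    (P : probability Omega R) (N : Omega -> R -> nat) : Prop :=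
  forall (m : nat) (t : nat -> R) (U : nat -> set int),
    0 <= t 0 -> {homo t : i j / (i <= j)%N >-> i <= j} ->
    (P [set w | forall i, (i < m)%N -> U i (increment (N w) (t i) (t i.+1))] =
     \prod_(i < m) P [set w | U i (increment (N w) (t i) (t i.+1))])%E.

(** [poisson_prob r k] is the Poisson law of parameter r, the Dirac mass at 0 if
    r = 0; it ignores its argument k. *)
Definition poisson_process (R : realType) d (Omega : measurableType d)
    (P : probability Omega R) (lambda : R) (N : Omega -> R -> nat) : Prop :=
  [/\ P [set w | N w 0 = 0%N] = 1%E,
      independent_increments P N &
      forall (s t : R) (n : nat), 0 <= s -> s <= t ->
        P [set w | increment (N w) s t = n%:Z] =
        poisson_prob (lambda * (t - s)) 0 [set n] ].

Section exclusion.
Context (R : realType) (S : countType).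

Definition edge := {p : S * S | p.1 != p.2}.

Definition path_family := prod_topology (fun _ : edge => @cadlag_path R nat).

Definition path_space := g_sigma_algebraType (@open path_family).

Definition independent_processes (P : probability path_space R) : Prop :=
  forall (F : {fset edge}) (B : edge -> set (@cadlag_path R nat)),
    (forall e, borel (B e)) ->
    (P [set K : path_space | forall e, e \in F -> B e (K e)] =
     \prod_(e <- F) P [set K : path_space | B e (K e)])%E.

Definition poisson_family (c : S -> S -> R) (P : probability path_space R) :
    Prop :=
  independent_processes P /\
  forall e : edge, poisson_process P (c (val e).1 (val e).2)
    (fun (K : path_space) t => K e t).

(** K_{x,y}(t), with the convention K_{x,x} = 0. *)
Definition count (K : path_family) (x y : S) (t : R) : nat :=
  if insub (x, y) is Some e then K e t else 0.

Definition count_sym (K : path_family) (x y : S) (t : R) : nat :=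
  (count K x y t + count K y x t)%N.

Definition graph (t0 : R) (K : path_family) (r : nat) : rel S :=
  [rel x y | (x != y) &&
     (count_sym K x y (r%:R * t0) < count_sym K x y (r.+1%:R * t0))%N].

Definition component (t0 : R) (K : path_family) (r : nat) (x : S) : set S :=
  [set y | exists2 p : seq S, path (graph t0 K r) x p & y = last x p].

Definition finite_components (t0 : R) (r : nat) : set path_family :=
  [set K | forall x, finite_set (component t0 K r x)].

Definition Gamma_star (t0 : R) : set path_family :=
  [set K |
    [/\ forall r, finite_components t0 r K,
        forall x t, 0 <= t ->
          (\esum_(y in [set~ x]) (count_sym K x y t)%:R%:E < +oo :> \bar R)%E,
        (forall (e e' : edge) s, e <> e' ->
           jump_time (K e) s -> ~ jump_time (K e') s) /\
        (forall (e : edge) s,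
           jump_time (K e) s -> K e s = (left_lim (K e) s).+1) &
        forall e : edge, K e 0 = 0%N ] ].

Definition config := prod_topology (fun _ : S => bool).

Definition jump (K : path_family) (x y : S) (s : R) : Prop :=
  count K x y s = (left_lim (count K x y) s).+1.

Definition moves (K : path_family) (C : set S) (s : R) (eta : config)
    (x y : S) : Prop :=
  [/\ C x /\ C y, x <> y, jump K x y s & eta x && ~~ eta y].

(** On Gamma_star, [moves K C s eta] holds for at most one pair of sites. *)
Definition update (K : path_family) (C : set S) (s : R) (eta : config) :
    config :=
  fun z => if `[< exists y, moves K C s eta z y >] then false
           else if `[< exists x, moves K C s eta x z >] then true
           else eta z.

Definition jump_times (t0 : R) (K : path_family) (r : nat) (C : set S) (t : R) :
    set R :=
  [set s | r%:R * t0 < s <= t /\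
           exists x y, [/\ C x, C y, x <> y & jump K x y s]].

(** Configuration at time t in [r t0, (r+1) t0], starting from eta at r t0. *)
Definition flow (t0 : R) (K : path_family) (r : nat) (eta : config) (t : R) :
    config :=
  fun x => let C := component t0 K r x in
    foldl (fun xi s => update K C s xi) eta
      (sort <=%R (fset_set (jump_times t0 K r C t))) x.

Fixpoint eta_grid (t0 : R) (K : path_family) (sigma : config) (r : nat) :
    config :=
  if r is r'.+1 then flow t0 K r' (eta_grid t0 K sigma r') (r%:R * t0)
  else sigma.

(** Here r t0 <= t < (r+1) t0. For t = r t0 no jump remains to be performed and
    the value is [eta_grid t0 K sigma r], so that this agrees with splitting
    time into the intervals (r t0, (r+1) t0]. *)
Definition eta (t0 : R) (K : path_family) (sigma : config) (t : R) : config :=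
  let r := Num.truncn (t / t0) in flow t0 K r (eta_grid t0 K sigma r) t.

(** The trajectories are only meaningful on Gamma_star, an event of
    probability 1. *)
Definition semigroup (P : probability path_space R) (t0 t : R)
    (f : config -> R) : config -> R :=
  fun sigma =>
    \int[P]_(K in (Gamma_star t0 : set path_space)) f (eta t0 K sigma t).

Definition unorm (f : config -> R) : \bar R :=
  ereal_sup [set `|f xi|%:E | xi in [set: config]].

(** f is in C({0,1}^S) and (S(t) f - f) / t converges to g in C({0,1}^S). *)
Definition generator_limit (P : probability path_space R) (t0 : R)
    (f g : config -> R) : Prop :=
  [/\ continuous f, continuous g &
      unorm (fun xi => (semigroup P t0 t f xi - f xi) / t - g xi)
        @[t --> 0^'+] --> 0%E ].

Definition generator_domain (P : probability path_space R) (t0 : R) :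
    set (config -> R) :=
  [set f | exists g, generator_limit P t0 f g].

Definition generator (P : probability path_space R) (t0 : R)
    (f : config -> R) : config -> R :=
  xget (fun=> 0) [set g | generator_limit P t0 f g].

(** g is the sum in C({0,1}^S) of the series of the F i, in the sense of
    unordered (unconditional) summation. *)
Definition has_sum (I : choiceType) (F : I -> config -> R) (g : config -> R) :
    Prop :=
  continuous g /\
  unorm (fun xi => \sum_(i <- A) F i xi - g xi)
    @[A --> (totally : set_system {fset I})] --> 0%E.

(** The sum is unique; it is set to 0 if the series does not converge. *)
Definition series_sum (I : choiceType) (F : I -> config -> R) : config -> R :=
  xget (fun=> 0) [set g | has_sum F g].

Definition absolutely_convergent (I : choiceType) (F : I -> config -> R) :
    Prop :=
  (forall i, continuous (F i)) /\ (\esum_(i in [set: I]) unorm (F i) < +oo)%E.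

Definition exchange (xi : config) (x y : S) : config :=
  fun z => if z == x then xi y else if z == y then xi x else xi z.

Definition exclusion_term (c : S -> S -> R) (f : config -> R) (x y : S) :
    config -> R :=
  fun xi => c x y * (xi x)%:R * (1 - (xi y)%:R) * (f (exchange xi x y) - f xi).

Definition Delta (f : config -> R) (x : S) : \bar R :=
  ereal_sup [set d | exists xi zeta : config,
    (forall y, y <> x -> xi y = zeta y) /\ d = `|f xi - f zeta|%:E].

(** c^s_x, an extended real, as its finiteness is a consequence of
    the finiteness of the graph components, not a definitional fact. *)
Definition total_rate (c : S -> S -> R) (x : S) : \bar R :=
  \esum_(y in [set: S]) (c x y + c y x)%:E.

End exclusion.

(* Main.v *)
Require Import Defs.
From HB Require Import structures.
From mathcomp Require Import all_boot all_order all_algebra.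
From mathcomp Require Import finmap.
From mathcomp Require Import all_classical all_reals all_analysis.
From mathcomp.analysis.showcase Require Import summability.
From mathcomp Require Import measurable_realfun.
From mathcomp Require Import zify ring lra.

Set Implicit Arguments.
Unset Strict Implicit.
Unset Printing Implicit Defensive.

Import Order.TTheory GRing.Theory Num.Theory.
Import numFieldNormedType.Exports.

Local Open Scope classical_set_scope.
Local Open Scope ring_scope.

(** The generator acts on f through the first jumps of the clocks, so the point
    is to show that, in mean and uniformly in the initial configuration sigma,
    the value f (eta_t) is f sigma plus the sum over the ringing pairs of the
    effect on sigma of one attempted jump, up to an error o(t). Infinitely many
    pairs may ring before any time t > 0, so that there is no first jump, and the
    argument is localized to a finite set F of ordered pairs.

    Changing a configuration one site at a time and passing to the limit by
    continuity gives [diff_le_Delta]: the variation of f between two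
    configurations is at most the sum of Delta f over the sites where they
    differ. Hence the pairs outside F contribute to f (eta_t) at most the sum of
    Delta f q.1 + Delta f q.2 over the ringing q outside F, whose mean is at most
    t times the tail outside F of c_q (Delta f q.1 + Delta f q.2). This family is
    summable, its sum being that of c^s_x Delta f x ([term_bound_summable]).

    For the pairs of F, call it a conflict when one of them rings twice, or rings
    together with another pair of F or with a pair that shares a site with it.
    Without conflict at most one pair of F rings, and it acts on sigma as an
    isolated attempted jump ([eta_one_jump]). Independence of the clocks and
    finiteness of the total rates c^s_x bound the probability of a conflict by
    C_F t^2. Taking means, (S(t) f - f) / t differs from the announced series by
    at most twice the tail plus a constant depending on F times t
    ([quotient_bound]); let t go to 0 after having chosen F.

    This needs that almost every trajectory lies in Gamma_star
    ([ae_Gamma_star]). Jumps of one clock have size one and different clocks do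
    not jump together, because on a grid of mesh 1/n the probability of seeing
    two jumps in one cell is O(1/n) in total. The graph of each later time window
    has the law of the first one, the two laws agreeing on the events that all
    pairs of a given finite set ring ([window_edges_law]); so all window graphs
    have finite components. The total rates are finite since otherwise, by
    independence, a site would have infinitely many neighbours in the first
    window ([total_rate_fin]).

    All probabilities are computed from values of the clocks at fixed times,
    which are Borel functions of the paths ([borel_eval_eq]). The integral of
    f (eta_t) itself is only ever squeezed between integrals of measurable
    functions ([integral_squeeze]). *)

(** * Unordered sums of extended reals *)

Section esum_facts.
Context {R : realType}.
Local Open Scope ereal_scope.

Lemma esum_fsetE (I : choiceType) (a : I -> \bar R) (F : {fset I}) :
  (forall i, 0 <= a i) -> \esum_(i in [set` F]) a i = \sum_(i <- F) a i.
Proof.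
move=> a0; rewrite esum_fset; [|exact: finite_fset|by []].
by rewrite fsbig_finite//= set_fsetK.
Qed.

Lemma esum_split_fset (I : choiceType) (a : I -> \bar R) (F : {fset I}) :
  (forall i, 0 <= a i) ->
  \esum_(i in [set: I]) a i =
  \sum_(i <- F) a i + \esum_(i in ~` [set` F]) a i.
Proof.
by move=> a0; rewrite (esumID [set` F])// !setTI esum_fsetE.
Qed.

Lemma esum_tail (I : choiceType) (a : I -> \bar R) (e : R) :
  (forall i, 0 <= a i) -> \esum_(i in [set: I]) a i < +oo -> (0 < e)%R ->
  exists F : {fset I}, \esum_(i in ~` [set` F]) a i < e%:E.
Proof.
move=> a0 aoo e0.
have afin : \esum_(i in [set: I]) a i \is a fin_num.
  by rewrite ge0_fin_numE// esum_ge0.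
have [_ [X [finX _] <-] Xe] := ub_ereal_sup_adherent e0 afin.
exists (fset_set X).
move: (esum_split_fset (fset_set X) a0) Xe.
rewrite -/(esum [set: I] a) fsbig_finite//= => ->.
have s0 : 0 <= \sum_(i <- fset_set X) a i by exact: sume_ge0.
have sfin : \sum_(i <- fset_set X) a i \is a fin_num.
  rewrite ge0_fin_numE//; apply: le_lt_trans aoo.
  by rewrite (esum_split_fset (fset_set X))// leeDl// esum_ge0.
by rewrite EFinN lteBlDr// lteD2lE.
Qed.

Lemma esum_pickle (I : countType) (A : set I) (a : I -> \bar R) :
  (forall i, 0 <= a i) ->
  \esum_(i in A) a i =
  \sum_(n <oo) oapp (fun i => if i \in A then a i else 0) 0 (pickle_inv n).
Proof.
move=> a0; set b := oapp _ _.
have b0 i : 0 <= b i by case: i => //= i; case: ifP.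
rewrite nneseries_esumT//.
rewrite (esumID (range (choice.pickle : I -> nat)))// setTI [X in _ + X]esum1 ?adde0; last first.
  move=> n [_ /= nr]; have := @pickle_invK I n.
  by case: pickle_inv => //= i ni; exfalso; apply: nr; exists i.
rewrite esum_image; last by move=> i j _ _; exact: (pcan_inj (@pickleK_inv I)).
by rewrite esum_mkcond; apply: eq_esum => i _; rewrite /b pickleK_inv.
Qed.

(** Real series are handled as differences of two sums of non-negative terms:
    this single estimate serves for the double series, for its rows and for the
    sum of the rows, where the two parts are themselves infinite sums. *)
Lemma esum_diff_approx (I : choiceType) (p n b : I -> \bar R) (F : {fset I}) :
  (forall i, 0 <= p i) -> (forall i, 0 <= n i) -> (forall i, p i + n i <= b i) ->
  \esum_(i in [set: I]) b i < +oo ->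
  (`|\sum_(i <- F) (fine (p i) - fine (n i)) -
     (fine (\esum_(i in [set: I]) p i) - fine (\esum_(i in [set: I]) n i))|%R%:E
   <= \esum_(i in ~` [set` F]) b i).
Proof.
move=> p0 n0 pnb boo.
have fin a : (forall i, 0 <= a i) -> (forall i, a i <= b i) ->
    [/\ forall i, a i \is a fin_num, \esum_(i in [set: I]) a i \is a fin_num &
        \esum_(i in ~` [set` F]) a i \is a fin_num].
  move=> a0 ab.
  have aoo : \esum_(i in [set: I]) a i < +oo.
    by apply: le_lt_trans boo; exact: le_esum.
  split.
  - move=> i; rewrite ge0_fin_numE//; apply: le_lt_trans aoo.
    apply: esum_ge; exists [set i]; first by split.
    by rewrite fsbig_set1.
  - by rewrite ge0_fin_numE// esum_ge0.
  - rewrite ge0_fin_numE ?esum_ge0//; apply: le_lt_trans aoo.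
    by rewrite [leRHS](esum_split_fset F)// leeDr// sume_ge0.
have [pf Pf Pt] := fin p p0 (fun i => le_trans (leeDl _ (n0 i)) (pnb i)).
have [nf Nf Nt] := fin n n0 (fun i => le_trans (leeDr _ (p0 i)) (pnb i)).
have sp : fine (\esum_(i in [set: I]) p i) =
    (\sum_(i <- F) fine (p i) + fine (\esum_(i in ~` [set` F]) p i))%R.
  rewrite (esum_split_fset F)// fineD//; first by rewrite -sum_fine.
  by rewrite sum_fin_num all_map; apply/allP => i _ /=.
have sn : fine (\esum_(i in [set: I]) n i) =
    (\sum_(i <- F) fine (n i) + fine (\esum_(i in ~` [set` F]) n i))%R.
  rewrite (esum_split_fset F)// fineD//; first by rewrite -sum_fine.
  by rewrite sum_fin_num all_map; apply/allP => i _ /=.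
apply: (@le_trans _ _ (\esum_(i in ~` [set` F]) (p i + n i))); last exact: le_esum.
rewrite esumD// -(fineK Pt) -(fineK Nt) -EFinD lee_fin sp sn sumrB.
set u := fine _; set v := fine _.
have u0 : (0 <= u)%R by rewrite fine_ge0// esum_ge0.
have v0 : (0 <= v)%R by rewrite fine_ge0// esum_ge0.
rewrite opprB addrACA opprD !addrA.
rewrite (_ : (_ + _ - _)%R = (v - u)%R); last by ring.
by rewrite (le_trans (ler_normB _ _))// !ger0_norm// addrC.
Qed.

Lemma esum_wpM2r (I : choiceType) (A : set I) (a : I -> \bar R) (k : \bar R) :
  (forall i, 0 <= a i) -> 0 <= k ->
  \esum_(i in A) (a i * k) <= (\esum_(i in A) a i) * k.
Proof.
move=> a0 k0; apply: ge_ereal_sup => _ [X [finX XA] <-].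
rewrite -ge0_mule_fsuml// lee_wpmul2r//.
by apply: ereal_sup_ubound; exists X.
Qed.

End esum_facts.

Lemma esum_subset {R : realType} (I : choiceType) (A B : set I) (a : I -> \bar R) :
  (forall i, 0 <= a i)%E -> A `<=` B ->
  (\esum_(i in A) a i <= \esum_(i in B) a i)%E.
Proof.
move=> a0 AB; apply: ge_ereal_sup => _ [X [finX XA] <-].
by apply: ereal_sup_ubound; exists X => //; split => // i /XA /AB.
Qed.

(** * Limits and sums in the uniform norm *)

Lemma cvge_to0 {R : realType} (T : Type) (F : set_system T) (FF : Filter F)
    (u : T -> \bar R) :
  (forall t, 0 <= u t)%E ->
  (forall e : R, 0 < e -> \forall t \near F, (u t <= e%:E)%E) ->
  u t @[t --> F] --> 0%E.
Proof.
move=> u0 ue; apply/fine_cvgP; split.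
  move: (ue _ ltr01); apply: filterS => t ut.
  by rewrite ge0_fin_numE// (le_lt_trans ut)// ltry.
apply/cvgrPdist_le => e e0; move: (ue _ e0); apply: filterS => t ut /=.
rewrite sub0r normrN ger0_norm ?fine_ge0// -lee_fin fineK//.
by rewrite ge0_fin_numE// (le_lt_trans ut)// ltry.
Qed.

Section sup_norm.
Context {R : realType} {S : countType}.
Implicit Types (f g h : config S -> R).
Local Open Scope ereal_scope.

Lemma unorm_ub f (xi : config S) : `|f xi|%:E <= unorm f.
Proof. by apply: ereal_sup_ubound; exists xi. Qed.

Lemma unorm_ge0 f : 0 <= unorm f.
Proof. by apply: le_trans (unorm_ub f (fun=> false)); rewrite lee_fin. Qed.

Lemma unorm_le f (b : \bar R) : (forall xi, `|f xi|%:E <= b) -> unorm f <= b.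
Proof. by move=> fb; apply: ge_ereal_sup => _ [xi _ <-]. Qed.

(** Uniqueness lets the generator and the sums of series, which are chosen among
    all limits, be identified by exhibiting one limit. *)
Lemma unorm_lim_unique (T : Type) (F : set_system T) (FF : ProperFilter F)
    (u : T -> config S -> R) g h :
  unorm (fun xi => u t xi - g xi)%R @[t --> F] --> 0 ->
  unorm (fun xi => u t xi - h xi)%R @[t --> F] --> 0 -> g = h.
Proof.
move=> ug uh; apply/funext => xi; apply/eqP; rewrite -subr_eq0 -normr_le0.
rewrite -lee_fin.
have : unorm (fun xi => u t xi - g xi)%R + unorm (fun xi => u t xi - h xi)%R
    @[t --> F] --> 0 + 0 by apply: cvgeD.
rewrite adde0; apply: cvge_ge.
near=> t; rewrite (le_trans _ (leeD (unorm_ub _ xi) (unorm_ub _ xi)))//.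
rewrite -EFinD lee_fin distrC [X in (_ <= _ + X)%R]distrC.
rewrite addrC; have := ler_normD (h xi - u t xi)%R (u t xi - g xi)%R.
by rewrite addrA subrK addrC [leRHS]addrC.
Unshelve. all: by end_near. Qed.

Lemma has_sum_unique (I : choiceType) (F : I -> config S -> R) g h :
  has_sum F g -> has_sum F h -> g = h.
Proof. 
move=> [_ Fg] [_ Fh]; exact: (unorm_lim_unique totally_filter Fg Fh).
Qed.

Lemma series_sumE (I : choiceType) (F : I -> config S -> R) g :
  has_sum F g -> series_sum F = g.
Proof.
move=> Fg; apply: (@has_sum_unique _ F) => //.
by rewrite /series_sum; case: xgetP => // /(_ g).
Qed.

Lemma generator_limitE (P : probability (path_space R S) R) (t0 : R) f g :
  generator_limit P t0 f g -> generator P t0 f = g.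
Proof.
move=> fg; have : generator_limit P t0 f (generator P t0 f).
  by rewrite /generator; case: xgetP => // /(_ g).
move=> [_ _ fh]; case: fg => _ _ fg.
exact: (unorm_lim_unique _ fh fg).
Qed.

Lemma uniform_approx_continuous g :
  (forall e : R, (0 < e)%R -> exists2 h, continuous h &
    forall xi, (`|h xi - g xi| <= e)%R) -> continuous g.
Proof.
move=> gh xi; apply/cvgrPdist_lt => e e0.
have e3 : (0 < e / 3)%R by rewrite divr_gt0.
have [h ch hg] := gh _ e3.
move/cvgrPdist_lt : (ch xi) => /(_ _ e3); apply: filterS => z hz.
move: (hg xi) (hg z) hz.
have -> : (g xi - g z = (g xi - h xi) + ((h xi - h z) + (h z - g z)))%R by ring.
move=> h1 h2 h3; rewrite (le_lt_trans (ler_normD _ _))//.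
have := ler_normD (h xi - h z)%R (h z - g z)%R.
rewrite distrC in h1.
by move: h1 h2 h3; move: `|_|%R `|_|%R `|_|%R `|_|%R => a1 a2 a3 a4; lra.
Qed.

Lemma has_sum_dominated (I : choiceType) (F : I -> config S -> R) g
    (b : I -> \bar R) :
  (forall i, 0 <= b i) -> \esum_(i in [set: I]) b i < +oo ->
  (forall i, continuous (F i)) ->
  (forall (A : {fset I}) xi, `|\sum_(i <- A) F i xi - g xi|%R%:E <=
     \esum_(i in ~` [set` A]) b i) ->
  has_sum F g.
Proof.
move=> b0 boo cF Fg.
have cFA (A : {fset I}) : continuous (fun xi => \sum_(i <- A) F i xi)%R.
  apply: continuous_big => [|i _]; [exact: add_continuous|exact: cF].
split.
  apply: uniform_approx_continuous => e e0.
  have [A Ae] := esum_tail b0 boo e0.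
  exists (fun xi => \sum_(i <- A) F i xi)%R => // xi.
  by rewrite -lee_fin (le_trans (Fg _ _))// ltW.
apply: (@cvge_to0 _ _ _ totally_filter) => [A|e e0]; first exact: unorm_ge0.
have [A Ae] := esum_tail b0 boo e0.
exists A => //= B AB; apply: unorm_le => xi.
rewrite (le_trans (Fg B xi))// (le_trans _ (ltW Ae))//.
apply: esum_subset => // i /= /negP iB; apply/negP; apply: contra iB.
by move/fsubsetP : AB; apply.
Qed.

End sup_norm.

(** * Continuity and oscillation of functions of the configuration *)

Section config_topology.
Context {R : realType} {S : countType}.
Implicit Types (xi zeta : config S) (f : config S -> R).

(** The topology on the two-point set is discrete, so continuity on
    configurations is a matter of eventual equality at each site. *)
Lemma config_coord_near xi z : \forall zeta \near xi, zeta z = xi z.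
Proof.
have /= := @proj_continuous S (fun=> bool) z xi [set xi z].
by apply; exact: (discrete_set1 (xi z)).
Qed.

Lemma config_cvg (T : Type) (F : set_system T) (FF : Filter F)
    (h : T -> config S) xi :
  (forall x, \forall t \near F, h t x = xi x) -> h t @[t --> F] --> xi.
Proof.
move=> hxi; apply/cvg_sup => x A /= [B [[C oC CB] Bxi BA]].
move: (hxi x); apply: filterS => t htx; apply: BA; rewrite -CB /= htx.
by move: Bxi; rewrite -CB.
Qed.

Lemma exchange_continuous x y :
  continuous (fun xi : config S => exchange xi x y : config S).
Proof.
move=> xi; apply: config_cvg => z.
near=> zeta; rewrite /exchange.
have -> : zeta x = xi x by near: zeta; exact: config_coord_near.
have -> : zeta y = xi y by near: zeta; exact: config_coord_near.
by have -> : zeta z = xi z by near: zeta; exact: config_coord_near.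
Unshelve. all: by end_near. Qed.

Lemma coord_continuous x : continuous (fun xi : config S => (xi x)%:R : R).
Proof.
move=> xi; apply/cvgrPdist_lt => e e0.
have := config_coord_near xi x; apply: filterS => zeta ->.
by rewrite subrr normr0.
Qed.

Lemma exclusion_term_continuous (c : S -> S -> R) f x y :
  continuous f -> continuous (exclusion_term c f x y).
Proof.
move=> cf xi; rewrite /exclusion_term; apply: cvgM; last first.
  apply: cvgB; last exact: cf.
  by apply: (continuous_cvg _ (cf _)); exact: exchange_continuous.
apply: cvgM.
  by apply: cvgM; [exact: cvg_cst|exact: coord_continuous].
by apply: cvgB; [exact: cvg_cst|exact: coord_continuous].
Qed.

End config_topology.

Section oscillation.
Context {R : realType} {S : countType}.
Implicit Types (xi zeta : config S) (f : config S -> R).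
Local Open Scope ereal_scope.

Lemma Delta_ub f xi zeta x : (forall y, y <> x -> xi y = zeta y) ->
  `|f xi - f zeta|%:E <= Delta f x.
Proof. by move=> xz; apply: ereal_sup_ubound; exists xi, zeta. Qed.

Lemma Delta_ge0 f x : 0 <= Delta f x.
Proof.
by apply: le_trans (@Delta_ub f (fun=> false) (fun=> false) x _); rewrite ?lee_fin.
Qed.

Let hybrid xi zeta n : config S :=
  fun x => if (choice.pickle x < n)%N then xi x else zeta x.

(** Changing the sites one at a time costs [Delta f] at each modified site, and
    continuity lets the number of modified sites be infinite. *)
Lemma diff_le_Delta f xi zeta : continuous f ->
  `|f xi - f zeta|%:E <= \esum_(x in [set x | xi x != zeta x]) Delta f x.
Proof.
move=> cf.
set A := [set x | _].
pose a n := oapp (fun x => if x \in A then Delta f x else 0) 0 (@pickle_inv S n).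
have a0 n : 0 <= a n.
  by rewrite /a; case: pickle_inv => //= x; case: ifP => // _; exact: Delta_ge0.
have step n : `|f (hybrid xi zeta n) - f zeta|%:E <= \sum_(0 <= k < n) a k.
  elim: n => [|n IHn].
    rewrite big_geq// (_ : hybrid _ _ _ = zeta)//.
    by rewrite subrr normr0.
  rewrite big_nat_recr//=.
  rewrite -(subrK (f (hybrid xi zeta n)) (f (hybrid _ _ n.+1))) -addrA.
  apply: (@le_trans _ _ (`|f (hybrid xi zeta n.+1) - f (hybrid xi zeta n)|%:E +
      `|f (hybrid xi zeta n) - f zeta|%:E)).
    by rewrite -EFinD lee_fin ler_normD.
  rewrite addeC leeD// /a; case E : pickle_inv => [x|] /=.
    have nx : choice.pickle x = n by have := @pickle_invK S n; rewrite E.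
    have hy y : y <> x -> hybrid xi zeta n.+1 y = hybrid xi zeta n y.
      move=> yx; rewrite /hybrid ltnS leq_eqVlt.
      case: eqP => //= yn; exfalso; apply: yx.
      by apply: (pcan_inj (@pickleK_inv S)); rewrite yn nx.
    case: ifPn => [_|/negP xA]; first exact: Delta_ub.
    rewrite (_ : hybrid xi zeta n.+1 = hybrid xi zeta n) ?subrr ?normr0//.
    apply/funext => y; have [->|/eqP/hy//] := eqVneq y x.
    rewrite /hybrid nx ltnSn ltnn; apply/eqP/negPn/negP => xz.
    by apply: xA; rewrite inE.
  rewrite (_ : hybrid xi zeta n.+1 = hybrid xi zeta n) ?subrr ?normr0//.
  apply/funext => y; rewrite /hybrid ltnS leq_eqVlt; case: eqP => //= yn.
  by move: E; rewrite -yn pickleK_inv.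
have hxi : hybrid xi zeta n @[n --> \oo] --> xi.
  apply: config_cvg => x; exists (choice.pickle x).+1 => // n /= xn.
  by rewrite /hybrid xn.
have : `|f (hybrid xi zeta n) - f zeta|%:E @[n --> \oo] --> `|f xi - f zeta|%:E.
  apply: cvg_EFin; first by near=> n.
  apply: cvg_norm; apply: cvgB; last exact: cvg_cst.
  by apply: continuous_cvg => //; exact: cf.
apply: cvge_le; near=> n.
rewrite (le_trans (step n))// esum_pickle; last exact: Delta_ge0.
exact: nneseries_lim_ge.
Unshelve. all: by end_near. Qed.

(** An exchange modifies x first and then y, through the configuration that
    carries the value of y at both sites. *)
Lemma exchange_diff_le f xi x y :
  `|f (exchange xi x y) - f xi|%:E <= Delta f x + Delta f y.
Proof.
have [<-|xy] := eqVneq x y.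
  rewrite (_ : exchange xi x x = xi) ?subrr ?normr0; last first.
    by apply/funext => z; rewrite /exchange; case: eqP => // ->.
  by rewrite adde_ge0// Delta_ge0.
pose zeta : config S := fun z => if z == x then xi y else xi z.
apply: (@le_trans _ _ (`|f zeta - f xi|%:E + `|f (exchange xi x y) - f zeta|%:E)).
  rewrite -EFinD lee_fin (le_trans _ (ler_normD _ _))//.
  by rewrite (_ : f zeta - f xi + _ = f (exchange xi x y) - f xi)%R//; ring.
apply: leeD; apply: Delta_ub => z zx; rewrite /exchange /zeta.
  by case: eqP zx.
by case: eqP => // _; case: eqP zx.
Qed.

Lemma exclusion_term_le (c : S -> S -> R) f xi x y : (0 <= c x y)%R ->
  `|exclusion_term c f x y xi|%:E <= (c x y)%:E * (Delta f x + Delta f y).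
Proof.
move=> c0; apply: (@le_trans _ _ ((c x y)%:E * `|f (exchange xi x y) - f xi|%:E)).
  rewrite -EFinM lee_fin /exclusion_term !normrM (ger0_norm c0).
  rewrite -mulrA -mulrA ler_wpM2l// mulrA ler_piMl//.
  by case: (xi x); case: (xi y); rewrite ?subrr ?subr0 ?normr0 ?normr1 ?mulr0 ?mul0r ?mulr1.
by rewrite lee_wpmul2l// exchange_diff_le.
Qed.

End oscillation.

(** * The series of the generator *)

Section generator_series.
Context {R : realType} {S : countType}.
Variables (c : S -> S -> R) (c_ge0 : forall x y, 0 <= c x y).
Variables (f : config S -> R) (f_cont : continuous f).
Local Open Scope ereal_scope.
Hypothesis (f_rate : \esum_(x in [set: S]) (total_rate c x * Delta f x) < +oo).

Definition term_bound (x y : S) : \bar R := (c x y)%:E * (Delta f x + Delta f y).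

Lemma term_bound_ge0 x y : 0 <= term_bound x y.
Proof. by rewrite mule_ge0 ?lee_fin// adde_ge0// Delta_ge0. Qed.

Lemma esum_pair (a : S -> S -> \bar R) : (forall x y, 0 <= a x y) ->
  \esum_(p in [set: S * S]) a p.1 p.2 =
  \esum_(x in [set: S]) \esum_(y in [set: S]) a x y.
Proof.
move=> a0; rewrite (@esum_esum R S S [set: S] (fun=> [set: S]) a)//.
by congr esum; apply/seteqP; split.
Qed.

Lemma esum_pair_swap (a : S -> S -> \bar R) :
  \esum_(p in [set: S * S]) a p.1 p.2 = \esum_(p in [set: S * S]) a p.2 p.1.
Proof.
rewrite (reindex_esum setT setT (fun p : S * S => (p.2, p.1)))//.
split => //= [[x y] [x' y'] _ _ [-> ->]//|[x y] _]; by exists (y, x).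
Qed.

(** Grouping the two terms of the bound by the site at which the oscillation is
    taken turns the double sum into the sum of c^s_x Delta f x. *)
Lemma term_bound_summable :
  \esum_(p in [set: S * S]) term_bound p.1 p.2 < +oo.
Proof.
apply: le_lt_trans f_rate.
have cD0 x y : 0 <= (c x y)%:E * Delta f x by rewrite mule_ge0 ?lee_fin// Delta_ge0.
have cD0' x y : 0 <= (c x y)%:E * Delta f y by rewrite mule_ge0 ?lee_fin// Delta_ge0.
rewrite (eq_esum (b := fun p => (c p.1 p.2)%:E * Delta f p.1 +
    (c p.1 p.2)%:E * Delta f p.2)); last first.
  by move=> p _; rewrite /term_bound ge0_muleDr// Delta_ge0.
rewrite esumD//.
rewrite (esum_pair_swap (fun x y => (c x y)%:E * Delta f y)) -esumD//.
rewrite (esum_pair (a := fun x y => (c x y)%:E * Delta f x + (c y x)%:E * Delta f x));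
  last by move=> x y; rewrite adde_ge0.
apply: le_esum => x _; rewrite (le_trans _ (esum_wpM2r _ _ _))//.
- by apply: le_esum => y _; rewrite EFinD ge0_muleDl ?lee_fin.
- by move=> y; rewrite lee_fin addr_ge0.
- exact: Delta_ge0.
Qed.

Lemma exclusion_term_summable :
  absolutely_convergent (fun p : S * S => exclusion_term c f p.1 p.2).
Proof.
split=> [p|]; first exact: exclusion_term_continuous.
apply: le_lt_trans term_bound_summable; apply: le_esum => p _.
by apply: unorm_le => xi; exact: exclusion_term_le.
Qed.

Let pos xi (x y : S) : \bar R := (Num.max (exclusion_term c f x y xi) 0)%:E.
Let neg xi (x y : S) : \bar R := (Num.max (- exclusion_term c f x y xi) 0)%:E.

Let pos_ge0 xi x y : 0 <= pos xi x y.
Proof. by rewrite lee_fin le_max lexx orbT. Qed.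

Let neg_ge0 xi x y : 0 <= neg xi x y.
Proof. by rewrite lee_fin le_max lexx orbT. Qed.

Let pos_neg xi x y :
  (fine (pos xi x y) - fine (neg xi x y))%R = exclusion_term c f x y xi.
Proof.
rewrite /pos /neg/=; move: (exclusion_term _ _ _ _ _) => a.
by case: (leP a 0%R) => a0; case: leP => a1; lra.
Qed.

Let pos_neg_le xi x y : pos xi x y + neg xi x y <= term_bound x y.
Proof.
apply: le_trans (exclusion_term_le _ xi (c_ge0 x y)).
rewrite /pos /neg -EFinD lee_fin; move: (exclusion_term _ _ _ _ _) => a.
by have [a0|a0] := ler0P a; have [a1|a1] := leP (- a)%R 0%R; lra.
Qed.

(** Defined through sums of non-negative terms, for which the sum over pairs and
    the iterated sum coincide. *)
Definition exclusion_sum : config S -> R := fun xi =>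
  (fine (\esum_(p in [set: S * S]) pos xi p.1 p.2) -
   fine (\esum_(p in [set: S * S]) neg xi p.1 p.2))%R.

Lemma exclusion_sum_approx (F : {fset S * S}) xi :
  `|\sum_(p <- F) exclusion_term c f p.1 p.2 xi - exclusion_sum xi|%R%:E <=
  \esum_(p in ~` [set` F]) term_bound p.1 p.2.
Proof.
under eq_bigr do rewrite -pos_neg.
apply: (esum_diff_approx (p := fun p => pos xi p.1 p.2)
  (n := fun p => neg xi p.1 p.2) (b := fun p => term_bound p.1 p.2)) => //.
exact: term_bound_summable.
Qed.

Lemma has_sum_exclusion :
  has_sum (fun p : S * S => exclusion_term c f p.1 p.2) exclusion_sum.
Proof.
apply: (has_sum_dominated (b := fun p => term_bound p.1 p.2)).
- by move=> p; exact: term_bound_ge0.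
- exact: term_bound_summable.
- by move=> p; exact: exclusion_term_continuous.
- exact: exclusion_sum_approx.
Qed.

Lemma exclusion_sum_continuous : continuous exclusion_sum.
Proof. by case: has_sum_exclusion. Qed.

Let row_bound x := \esum_(y in [set: S]) term_bound x y.

Let row_bound_ge0 x : 0 <= row_bound x.
Proof. by apply: esum_ge0 => y _; exact: term_bound_ge0. Qed.

Let row_bound_summable : \esum_(x in [set: S]) row_bound x < +oo.
Proof.
rewrite -esum_pair; first exact: term_bound_summable.
exact: term_bound_ge0.
Qed.

Let row_bound_fin x : row_bound x < +oo.
Proof.
apply: le_lt_trans row_bound_summable; apply: esum_ge.
by exists [set x]; [split|rewrite fsbig_set1].
Qed.

Let row_sum x : config S -> R := fun xi =>
  (fine (\esum_(y in [set: S]) pos xi x y) -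
   fine (\esum_(y in [set: S]) neg xi x y))%R.

Let has_sum_row x : has_sum (fun y => exclusion_term c f x y) (row_sum x).
Proof.
apply: (has_sum_dominated (b := term_bound x)).
- by move=> y; exact: term_bound_ge0.
- exact: row_bound_fin.
- by move=> y; exact: exclusion_term_continuous.
- move=> A xi; under eq_bigr do rewrite -pos_neg.
  apply: (esum_diff_approx (p := pos xi x) (n := neg xi x)) => //.
  exact: row_bound_fin.
Qed.

(** Each row sum is again a difference of two non-negative sums, and iterated
    non-negative sums agree with the sum over pairs. *)
Lemma series_sum_exclusion :
  series_sum (fun x => series_sum (fun y => exclusion_term c f x y)) =
  exclusion_sum.
Proof.
rewrite (_ : (fun x => _) = row_sum); last first.
  by apply/funext => x; exact: series_sumE (has_sum_row x).
apply: series_sumE; apply: (has_sum_dominated (b := row_bound)) => //.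
  by move=> x; case: (has_sum_row x).
move=> A xi; rewrite /exclusion_sum (esum_pair (pos_ge0 xi)) (esum_pair (neg_ge0 xi)).
apply: (esum_diff_approx (p := fun x => \esum_(y in [set: S]) pos xi x y)
   (n := fun x => \esum_(y in [set: S]) neg xi x y)) => //.
- by move=> x; exact: esum_ge0.
- by move=> x; exact: esum_ge0.
- by move=> x; rewrite -esumD//; apply: le_esum => y _; exact: pos_neg_le.
Qed.

End generator_series.

(** * Cadlag paths with integer values *)

Section cadlag_nat.
Context {R : realType}.
Implicit Types (w : R -> nat) (s t : R).

Lemma cadlag_right w t : cadlag w ->
  exists2 d : R, 0 < d & forall s, t <= s < t + d -> w s = w t.
Proof.
move=> /(_ t)[/(_ [set w t]) + _] => /(_ (discrete_set1 _)).
move=> [d /= d0 wd]; exists d => // s /andP[ts std].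
move: ts; rewrite le_eqVlt => /predU1P[->//|ts].
by apply: wd => //=; rewrite distrC ger0_norm ?subr_ge0 ?ltW// ltrBlDl.
Qed.

Lemma cadlag_left w t : cadlag w ->
  exists2 d : R, 0 < d & forall s, t - d < s < t -> w s = left_lim w t.
Proof.
move=> /(_ t)[_ /(_ [set left_lim w t])] => /(_ (discrete_set1 _)).
move=> [d /= d0 wd]; exists d => // s /andP[ts std].
apply: wd => //=.
by rewrite ger0_norm ?subr_ge0 ?ltW// ltrBlDl -ltrBlDr.
Qed.

Lemma nondecreasing_left_lim w s t : cadlag w ->
  {homo w : a b / a <= b >-> (a <= b)%N} -> s < t ->
  (w s <= left_lim w t)%N.
Proof.
move=> cw wh st; have [d d0 wd] := cadlag_left t cw.
pose u := Num.max s (t - d / 2).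
have ut : u < t by rewrite gt_max st/= ltrBlDr ltrDl divr_gt0.
rewrite -(wd u); first by apply: wh; rewrite le_max lexx.
rewrite ut andbT lt_max; apply/orP; right.
by rewrite ltrD2l ltrN2 ltr_pdivrMr// ltr_pMr// ltr1n.
Qed.

Lemma left_lim_nondecreasing w t : cadlag w ->
  {homo w : a b / a <= b >-> (a <= b)%N} -> (left_lim w t <= w t)%N.
Proof.
move=> cw wh; have [d d0 wd] := cadlag_left t cw.
rewrite -(wd (t - d / 2)); first by apply: wh; rewrite gerBl divr_ge0// ltW.
rewrite ltrD2l ltrN2 ltr_pdivrMr// ltr_pMr// ltr1n/=.
by rewrite ltrBlDr ltrDl divr_gt0.
Qed.

Lemma left_lim_npos (w : cadlag_path nat) t : t <= 0 :> R -> left_lim w t = w t.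
Proof.
move=> t0; have [d d0 wd] := cadlag_left t (path_cadlag w).
have dt : t - d / 2 < t by rewrite ltrBlDr ltrDl divr_gt0.
rewrite -(wd (t - d / 2)); last first.
  rewrite dt andbT ltrD2l ltrN2 ltr_pdivrMr// ltr_pMr// ltr1n//.
rewrite path_neg ?(lt_le_trans dt)//.
by move: t0; rewrite le_eqVlt => /predU1P[->//|t0]; rewrite path_neg.
Qed.

(** Right continuity reduces monotonicity to a countable set of times. *)
Lemma rat_nondecreasing (w : cadlag_path nat) :
  (forall p q : rat, 0 <= ratr p :> R -> ratr p <= ratr q :> R ->
     (w (ratr p) <= w (ratr q))%N) ->
  {homo w : s t / (s : R) <= t >-> (s <= t)%N}.
Proof.
move=> wq.
have w0 s t : 0 <= s -> s <= t -> (w s <= w t)%N.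
  move=> s0; rewrite le_eqVlt => /predU1P[->//|st].
  have [d d0 wd] := cadlag_right s (path_cadlag w).
  have [d' d'0 wd'] := cadlag_right t (path_cadlag w).
  have : s < Num.min (s + d) t by rewrite lt_min st ltrDl d0.
  move=> /rat_in_itvoo[p]; rewrite in_itv/= lt_min => /and3P[sp pd pt].
  have : t < t + d' by rewrite ltrDl.
  move=> /rat_in_itvoo[q]; rewrite in_itv/= => /andP[tq qd].
  rewrite -(wd (ratr p)) ?pd ?ltW// -(wd' (ratr q)) ?qd ?ltW//.
  apply: wq; first by rewrite ltW// (le_lt_trans s0).
  by rewrite ltW// (lt_trans pt).
move=> s t st; have [s0|s0] := leP 0 s; first exact: w0.
have [t0|t0] := leP 0 t; last by rewrite !path_neg.
by rewrite (path_neg w s0); exact: w0.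
Qed.

End cadlag_nat.

(** * Borel sets of path space *)

Section evaluation.
Context {R : realType}.
Let path := @cadlag_path R nat.

Let deviates (a b : R) (n : nat) : set path :=
  [set w | exists2 s, a < s < b & w s <> n].

(** A path that deviates from n inside an interval does so on a whole
    subinterval, so that the perturbed times of a nearby path still see it;
    evaluation at a fixed time has no such stability. *)
Let open_deviates a b n : 0 <= a -> open (deviates a b n).
Proof.
move=> a0; suff: skorohod_open (deviates a b n) by [].
move=> w [s /andP[as_ sb] wsn].
have [d d0 wd] := cadlag_right s (path_cadlag w).
pose d' := Num.min d (b - s).
have d'0 : 0 < d' by rewrite lt_min d0 subr_gt0.
have dd : d' / 2 < d' by rewrite ltr_pdivrMr// ltr_pMr// ltr1n.
have d20 : 0 < d' / 2 by rewrite divr_gt0.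
exists (s + d' / 2), (d' / 2); split => // v [lam _ wv].
have [|+ wb] := wv (s + d' / 2).
  by rewrite lexx andbT addr_ge0 ?ltW// (le_lt_trans a0).
rewrite ltr_norml => /andP[l1 l2].
exists (s + d' / 2).
  rewrite (lt_trans as_) ?ltrDl//=.
  have : d' <= b - s by rewrite ge_min lexx orbT.
  by move: dd; clear; lra.
have <- : w (lam (s + d' / 2)) = v (s + d' / 2) by move: wb; rewrite metric_discrete.
rewrite wd//; have : d' <= d by rewrite ge_min lexx.
by move: l1 l2 dd d20; clear; lra.
Qed.

(** By right continuity w t = n holds when w equals n on some interval just after
    t, and each such event is closed. *)
Lemma borel_eval_eq (t : R) (n : nat) : 0 <= t ->
  borel [set w : path | w t = n].
Proof.
move=> t0.
rewrite (_ : [set w | _] =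
    \bigcup_k ~` (deviates t (t + k.+1%:R^-1) n)); last first.
  apply/seteqP; split=> w /=.
    move=> wtn; have [d d0 wd] := cadlag_right t (path_cadlag w).
    have [k kd] := ltr_add_invr d0; rewrite add0r in kd.
    exists k => // -[s /andP[ts st]]; apply; rewrite wd// ltW//=.
    by rewrite (lt_trans st)// ltrD2l.
  move=> [k _ wk]; apply: contrapT => wtn; apply: wk.
  have [d d0 wd] := cadlag_right t (path_cadlag w).
  have k0 : 0 < k.+1%:R^-1 :> R by rewrite invr_gt0.
  pose e := Num.min d k.+1%:R^-1.
  have e0 : 0 < e by rewrite lt_min d0.
  have ee : e / 2 < e by rewrite ltr_pdivrMr// ltr_pMr// ltr1n.
  exists (t + e / 2).
    by rewrite ltrDl divr_gt0//= ltrD2l (lt_le_trans ee)// ge_min lexx orbT.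
  rewrite wd// lerDl divr_ge0 ?ltW//= ltrD2l (lt_le_trans ee)// ge_min lexx//.
apply: (@bigcup_measurable _ (g_sigma_algebraType (@open path))) => k _.
apply: measurableC; apply: sub_sigma_algebra; exact: open_deviates.
Qed.

Lemma borel_eval2 (s t : R) (Q : nat -> nat -> Prop) : 0 <= s -> 0 <= t ->
  borel [set w : path | Q (w s) (w t)].
Proof.
move=> s0 t0.
rewrite (_ : [set w | _] = \bigcup_m \bigcup_(n in Q m)
    ([set w : path | w s = m] `&` [set w : path | w t = n])); last first.
  apply/seteqP; split=> w /=; first by exists (w s) => //; exists (w t).
  by move=> [m _ [n + [-> ->]]].
apply: (@bigcup_measurable _ (g_sigma_algebraType (@open path))) => m _.
apply: (@bigcup_measurable _ (g_sigma_algebraType (@open path))) => n _.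
apply: measurableI; exact: borel_eval_eq.
Qed.

End evaluation.

Section path_space_measurability.
Context {R : realType} {S : countType}.

Lemma measurable_coord (e : edge S) (B : set (@cadlag_path R nat)) :
  borel B -> measurable ([set K | B (K e)] : set (path_space R S)).
Proof.
move=> mB.
have : measurable_fun setT
    (fun K : path_space R S => K e : g_sigma_algebraType (@open (@cadlag_path R nat))).
  apply: measurability; first by [].
  move=> _ [A oA <-]; rewrite setTI; apply: sub_sigma_algebra.
  apply: open_comp oA => K _.
  exact: (@proj_continuous (edge S) (fun=> @cadlag_path R nat) e).
by move=> /(_ measurableT _ mB); rewrite setTI.
Qed.

Lemma measurable_eval2 (e : edge S) (s t : R) (Q : nat -> nat -> Prop) :
  0 <= s -> 0 <= t ->
  measurable ([set K | Q (K e s) (K e t)] : set (path_space R S)).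
Proof.
by move=> s0 t0; exact: (measurable_coord e (borel_eval2 Q s0 t0)).
Qed.

End path_space_measurability.

(** * Increments of the Poisson clocks *)

Section poisson_increments.
Context {R : realType} {S : countType}.
Variables (c : S -> S -> R) (c_ge0 : forall x y, 0 <= c x y).
Variables (P : probability (path_space R S) R) (P_poisson : poisson_family c P).
Implicit Types (e : edge S) (s t : R) (K : path_space R S).

Let rate e := c (val e).1 (val e).2.

Let poisson0 (r : R) : 0 <= r -> poisson_prob r 0 [set 0%N] = (expR (- r))%:E.
Proof.
rewrite le_eqVlt /poisson_prob => /predU1P[<-|r0].
  by rewrite ltxx diracE mem_set// oppr0 expR0.
rewrite r0 esum_set1 ?lee_fin ?poisson_pmf_ge0// /poisson_pmf r0.
by rewrite expr0 fact0 invr1 !mul1r.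
Qed.

Let poisson1 (r : R) : 0 <= r -> poisson_prob r 0 [set 1%N] = (r * expR (- r))%:E.
Proof.
rewrite le_eqVlt /poisson_prob => /predU1P[<-|r0].
  by rewrite ltxx diracE memNset// mul0r.
rewrite r0 esum_set1 ?lee_fin ?poisson_pmf_ge0// /poisson_pmf r0.
by rewrite expr1 invr1 mulr1.
Qed.

Let P_incr e s t n : 0 <= s -> s <= t ->
  P [set K : path_space R S | K e t = (K e s + n)%N] =
  poisson_prob (rate e * (t - s)) 0 [set n].
Proof.
move=> s0 st; have [_ _ /(_ s t n s0 st) <-] := proj2 P_poisson e.
congr (P _); apply/seteqP; split=> K /=; rewrite /increment.
  by move=> ->; rewrite PoszD addrAC subrr add0r.
by move=> /eqP; rewrite subr_eq addrC -PoszD => /eqP [].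
Qed.

Let rate_ge0 e s t : s <= t -> 0 <= rate e * (t - s).
Proof. by move=> st; rewrite mulr_ge0 ?subr_ge0//; exact: c_ge0. Qed.

(** The Poisson masses of the non-negative increments already sum to one. *)
Let P_monotone e s t : 0 <= s -> s <= t ->
  P [set K : path_space R S | (K e s <= K e t)%N] = 1%E.
Proof.
move=> s0 st; have t0 := le_trans s0 st.
rewrite (_ : [set K : path_space R S | _] = \bigcup_n [set K : path_space R S | K e t = (K e s + n)%N]);
  last first.
  apply/seteqP; split=> K /=.
    by move=> st'; exists (K e t - K e s)%N => //=; rewrite subnKC.
  by move=> [n _ /= ->]; rewrite leq_addr.
have tI : trivIset setT (fun n => [set K : path_space R S | K e t = (K e s + n)%N]).
  by move=> i j _ _ [K /= [-> /eqP]]; rewrite eqn_add2l => /eqP.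
rewrite measure_bigcup//; last first.
  by move=> n _; exact: (measurable_eval2 e (fun a b => b = (a + n)%N)).
rewrite (eq_eseriesr (g := fun n => poisson_prob (rate e * (t - s)) 0 [set n]));
  last by move=> n _; exact: P_incr.
rewrite -(measure_bigcup (poisson_prob (rate e * (t - s)) 0))//; last first.
  by move=> i j _ _ [k /= [-> ->]].
rewrite (_ : \bigcup_n _ = setT); first exact: probability_setT.
by apply/seteqP; split=> // n _; exists n.
Qed.

Lemma P_hit e s t : 0 <= s -> s <= t ->
  P [set K : path_space R S | (K e s < K e t)%N] = (1 - expR (- (rate e * (t - s))))%:E.
Proof.
move=> s0 st; have t0 := le_trans s0 st.
have : (1 = P [set K : path_space R S | (K e s < K e t)%N] +
    (expR (- (rate e * (t - s))))%:E)%E.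
  rewrite -(P_monotone e s0 st) -poisson0 ?rate_ge0// -P_incr// -measureU.
  - congr (P _); apply/seteqP; split=> K /=; rewrite addn0.
      by rewrite leq_eqVlt => /predU1P[->|]; [right|left].
    by move=> [/ltnW|->].
  - exact: (measurable_eval2 e (fun a b => (a < b)%N)).
  - exact: (measurable_eval2 e (fun a b => b = (a + 0)%N)).
  - by apply/seteqP; split=> K //= [+ Kt]; rewrite Kt addn0 ltnn.
by move=> H; rewrite EFinB H addeK.
Qed.

Lemma P_hit_twice e s t : 0 <= s -> s <= t ->
  (P [set K : path_space R S | (K e s + 1 < K e t)%N] <= ((rate e * (t - s)) ^+ 2)%:E)%E.
Proof.
move=> s0 st; have t0 := le_trans s0 st.
have r0 := rate_ge0 e st; set r := rate e * (t - s) in r0 *.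
have : ((1 - expR (- r))%:E =
    P [set K : path_space R S | (K e s + 1 < K e t)%N] + (r * expR (- r))%:E)%E.
  rewrite -P_hit// -poisson1// -P_incr// -measureU.
  - congr (P _); apply/seteqP; split=> K /=; rewrite addn1.
      by rewrite leq_eqVlt => /predU1P[<-|]; [right|left].
    by move=> [/ltnW//|->].
  - exact: (measurable_eval2 e (fun a b => (a + 1 < b)%N)).
  - exact: (measurable_eval2 e (fun a b => b = (a + 1)%N)).
  - by apply/seteqP; split=> K //= [+ Kt]; rewrite Kt ltnn.
move=> H.
have -> : (P [set K : path_space R S | (K e s + 1 < K e t)%N] = (1 - expR (- r) - r * expR (- r))%:E)%E.
  by rewrite EFinB H addeK.
rewrite lee_fin; have e1 := expR_ge1Dx (- r).
suff : (1 + r) * (1 - r) <= (1 + r) * expR (- r) by lra.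
by rewrite ler_pM2l; lra.
Qed.

Lemma hit_prob_le (r : R) : 1 - expR (- r) <= r.
Proof. by have := expR_ge1Dx (- r); lra. Qed.

(** Together with [hit_prob_le], this says that a clock of parameter r rings with
    probability r + O(r^2). *)
Lemma hit_prob_ge (r : R) : 0 <= r -> r - r ^+ 2 <= 1 - expR (- r).
Proof.
move=> r0; have e1 := expR_ge1Dx r.
have ep : 0 < expR (- r) by exact: expR_gt0.
have : expR (- r) * expR r = 1 by rewrite -expRD addrC subrr expR0.
nra.
Qed.

Lemma P_independent2 e e' (s t s' t' : R) (Q Q' : nat -> nat -> Prop) :
  e <> e' -> 0 <= s -> 0 <= t -> 0 <= s' -> 0 <= t' ->
  (P [set K : path_space R S | Q (K e s) (K e t) /\ Q' (K e' s') (K e' t')] =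
   P [set K : path_space R S | Q (K e s) (K e t)] * P [set K : path_space R S | Q' (K e' s') (K e' t')])%E.
Proof.
move=> ee' s0 t0 s'0 t'0.
have /eqP ne : e' <> e by exact/nesym.
pose B x : set (cadlag_path nat) := if x == e then [set w | Q (w s) (w t)]
  else [set w | Q' (w s') (w t')].
have := proj1 P_poisson [fset e; e']%fset B.
rewrite big_fsetU1/= ?inE; last exact/eqP.
rewrite big_seq_fset1 /B eqxx (negPf ne) => <-.
  congr (P _); apply/seteqP; split=> K /=.
    move=> [Qe Qe'] x; rewrite !inE => /orP[]/eqP ->; first by rewrite eqxx.
    by rewrite (negPf ne).
  move=> H; split; [have := H e|have := H e']; rewrite ?eqxx ?(negPf ne);
    by apply; rewrite !inE eqxx ?orbT.
by move=> x; case: ifP => _; exact: borel_eval2.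
Qed.

Lemma P_all_hit (F : {fset edge S}) s t : 0 <= s -> s <= t ->
  (P [set K : path_space R S | forall e, e \in F -> (K e s < K e t)%N] =
   \prod_(e <- F) (1 - expR (- (rate e * (t - s))))%:E)%E.
Proof.
move=> s0 st; have t0 := le_trans s0 st.
rewrite (proj1 P_poisson F (fun=> [set w | (w s < w t)%N])).
  by apply: eq_bigr => e _; rewrite P_hit.
by move=> e; exact: (borel_eval2 (fun a b => (a < b)%N)).
Qed.

Lemma P_none_hit (F : {fset edge S}) s t : 0 <= s -> s <= t ->
  (P [set K : path_space R S | forall e, e \in F -> ~ (K e s < K e t)%N] =
   (expR (- \sum_(e <- F) (rate e * (t - s))))%:E)%E.
Proof.
move=> s0 st; have t0 := le_trans s0 st.
rewrite (proj1 P_poisson F (fun=> [set w | ~ (w s < w t)%N])); last first.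
  by move=> e; exact: (borel_eval2 (fun a b => ~ (a < b)%N)).
rewrite -sumrN expR_sum -prodEFin; apply: eq_bigr => e _.
rewrite (_ : mkset _ = ~` [set K : path_space R S | (K e s < K e t)%N])//.
rewrite probability_setC ?P_hit//; last first.
  exact: (measurable_eval2 e (fun a b => (a < b)%N)).
by rewrite -EFinB; congr (_%:E); ring.
Qed.

Lemma ae_nondecreasing_at e s t : 0 <= s -> s <= t ->
  {ae P, forall K, (K e s <= K e t)%N}.
Proof.
move=> s0 st; have t0 := le_trans s0 st.
exists (~` [set K : path_space R S | (K e s <= K e t)%N]); split => //.
  apply: measurableC; exact: (measurable_eval2 e (fun a b => (a <= b)%N)).
rewrite probability_setC ?P_monotone ?subee//.
exact: (measurable_eval2 e (fun a b => (a <= b)%N)).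
Qed.

Lemma ae_start0 e : {ae P, forall K, K e 0 = 0%N}.
Proof.
have m0 : measurable [set K : path_space R S | K e 0 = 0%N].
  exact: (measurable_eval2 e (fun a b => a = 0%N) (lexx 0) (lexx 0)).
exists (~` [set K : path_space R S | K e 0 = 0%N]); split => //; first exact: measurableC.
have [H _ _] := proj2 P_poisson e.
by rewrite probability_setC// H subee.
Qed.

End poisson_increments.

(** * Almost sure properties over countable families *)

Section almost_everywhere_facts.
Context d (T : measurableType d) (R : realType) (P : probability T R).
Local Open Scope ereal_scope.

Lemma negligible_countable (I : countType) (A : I -> set T) :
  (forall i, P.-negligible (A i)) -> P.-negligible (\bigcup_i A i).
Proof.
move=> A0.
apply: (@negligibleS _ _ _ _ (\bigcup_n oapp A set0 (@pickle_inv I n))).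
  by move=> x [i _ Ai]; exists (choice.pickle i) => //=; rewrite pickleK_inv.
apply: negligible_bigcup => n.
by case: pickle_inv => [i|] /=; [exact: A0|exact: negligible_set0].
Qed.

Lemma ae_countable (I : countType) (Q : I -> T -> Prop) :
  (forall i, {ae P, forall x, Q i x}) -> {ae P, forall x, forall i, Q i x}.
Proof.
move=> Qi; apply: negligibleS (negligible_countable Qi).
move=> x /existsNP[i nQ]; by exists i.
Qed.

Lemma ae_imply2 (Q1 Q2 Q : T -> Prop) : (forall x, Q1 x -> Q2 x -> Q x) ->
  {ae P, forall x, Q1 x} -> {ae P, forall x, Q2 x} -> {ae P, forall x, Q x}.
Proof.
move=> QQ A1 A2; apply: negligibleS (negligibleU A1 A2) => x /= nQ.
by apply: contrapT => /not_orP[/contrapT q1 /contrapT q2]; apply: nQ; exact: QQ.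
Qed.

Lemma ae_conj (Q1 Q2 : T -> Prop) : {ae P, forall x, Q1 x} ->
  {ae P, forall x, Q2 x} -> {ae P, forall x, Q1 x /\ Q2 x}.
Proof. exact: ae_imply2. Qed.

Lemma countable_forall_measurable (I : countType) (A : I -> set T) :
  (forall i, measurable (A i)) -> measurable [set x | forall i, A i x].
Proof.
move=> mA; rewrite (_ : mkset _ = ~` \bigcup_i ~` A i).
  by apply: measurableC; apply: countable_bigcupT_measurable => // i; exact: measurableC.
apply/seteqP; split=> x /=; first by move=> Ax [i _]; apply.
by move=> nA i; apply: contrapT => Ai; apply: nA; exists i.
Qed.

Lemma countable_exists_measurable (I : countType) (A : I -> set T) :
  (forall i, measurable (A i)) -> measurable [set x | exists i, A i x].
Proof.
move=> mA; rewrite (_ : mkset _ = \bigcup_i A i).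
  exact: countable_bigcupT_measurable.
by apply/seteqP; split=> x [i]; exists i.
Qed.

(** Refining grids: if every cell of the n-th grid is hit with probability
    O(1/n^2), almost surely some grid has no cell hit. *)
Lemma grid_negligible (A : nat -> nat -> set T) (C : R) :
  (forall n i, measurable (A n i)) ->
  (forall n i, P (A n i) <= (C / n.+1%:R ^+ 2)%:E) ->
  P.-negligible [set x | forall n, exists2 i, (i <= n)%N & A n i x].
Proof.
move=> mA PA; pose B n := \big[setU/set0]_(i < n.+1) A n i.
have mB n : measurable (B n) by exact: bigsetU_measurable.
exists (\bigcap_n B n); split.
- exact: bigcapT_measurable.
- have C0 : (0 <= C)%R.
    have := le_trans (measure_ge0 P _) (PA 0%N 0%N).
    by rewrite lee_fin expr1n divr1.
  apply/eqP; rewrite -measure_le0; apply/lee_addgt0Pr => e e0; rewrite add0e.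
  have [n Cn] : exists n, (C / n.+1%:R <= e)%R.
    have [n] := ltr_add_invr (divr_gt0 e0 (ltr_pwDr ltr01 C0)).
    rewrite add0r => ne; exists n; rewrite ler_pdivrMr//.
    move: ne; rewrite ltr_pdivlMr ?ltr_pwDr// mulrC ltr_pdivrMr// => /ltW.
    by apply: le_trans; rewrite lerDl.
  rewrite (@le_trans _ _ (P (B n)))//.
    apply: le_measure; rewrite ?inE//; first exact: bigcapT_measurable.
    by move=> x; apply.
  rewrite (le_trans (Boole_inequality _ _))//.
  apply: (@le_trans _ _ (\sum_(i < n.+1) (C / n.+1%:R ^+ 2)%:E)).
    by apply: lee_sum => i _; exact: PA.
  rewrite sumEFin lee_fin sumr_const card_ord (le_trans _ Cn)//.
  rewrite -[leLHS]mulr_natr; have : (n.+1%:R != 0 :> R)%R by rewrite pnatr_eq0.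
  by move: (n.+1%:R)%R => m m0; rewrite le_eqVlt; apply/orP; left; apply/eqP; field.
- move=> x /= Ax n _; have [i lin Ai] := Ax n.
  by rewrite /B -bigcup_mkord; exists i.
Qed.

(** First Borel-Cantelli lemma; an enumeration of I reduces it to sequences. *)
Lemma ae_finitely_many (I : countType) (A : I -> set T) :
  (forall i, measurable (A i)) -> \esum_(i in [set: I]) P (A i) < +oo ->
  {ae P, forall x, finite_set [set i | A i x]}.
Proof.
move=> mA; rewrite esum_pickle// => PA.
pose F n := oapp A set0 (@pickle_inv I n).
have mF n : measurable (F n) by rewrite /F; case: pickle_inv => [i|] /=.
exists (lim_sup_set F); split.
- by apply: bigcapT_measurable => n; apply: bigcup_measurable.
- apply: lim_sup_set_cvg0 => //.
  rewrite (eq_eseriesr (g := fun n => oapp (fun i =>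
    if i \in [set: I] then P (A i) else 0) 0 (@pickle_inv I n)))//.
  by move=> n _; rewrite /F; case: pickle_inv => [i|] /=; rewrite ?in_setT ?measure0.
- move=> x /= xinf n _; apply: contrapT => nF; apply: xinf.
  apply: (@sub_finite_set _ _ (\bigcup_(k in `I_n) [set i | pickle_inv k = Some i])).
    move=> i Ai; exists (choice.pickle i); last by rewrite /= pickleK_inv.
    rewrite /= ltnNge; apply/negP => ni; apply: nF; exists (choice.pickle i) => //.
    by rewrite /F pickleK_inv.
  apply: bigcup_finite => // k _.
  case: pickle_inv => [i|]; last by apply: (@sub_finite_set _ _ set0).
  by apply: (@sub_finite_set _ _ [set i]) => [j [->]|].
Qed.

End almost_everywhere_facts.

(** * Ringing of ordered pairs *)

Lemma hit_prob_ge0 {R : realType} (r : R) : 0 <= r -> 0 <= 1 - expR (- r).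
Proof. by move=> r0; rewrite subr_ge0 -expR0 ler_expR oppr_le0. Qed.

Section pair_counts.
Context {R : realType} {S : countType}.
Variables (c : S -> S -> R) (c_ge0 : forall x y, 0 <= c x y).
Hypothesis c_diag : forall x, c x x = 0.
Variables (P : probability (path_space R S) R) (P_poisson : poisson_family c P).
Implicit Types (e : edge S) (s t : R) (K : path_space R S) (p q : S * S).

Definition rings s t p : set (path_space R S) :=
  [set K | (Defs.count K p.1 p.2 s < Defs.count K p.1 p.2 t)%N].

Definition rings_twice s t p : set (path_space R S) :=
  [set K | (Defs.count K p.1 p.2 s + 1 < Defs.count K p.1 p.2 t)%N].

Lemma count_edge K (e : edge S) : Defs.count K (val e).1 (val e).2 = K e :> (R -> nat).
Proof.
by apply/funext => t; rewrite /Defs.count -surjective_pairing valK.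
Qed.

Lemma count_diag K x : Defs.count K x x = (fun=> 0%N) :> (R -> nat).
Proof. by apply/funext => t; rewrite /Defs.count insubF//= eqxx. Qed.

(** Statements on pairs of sites split into the diagonal, where nothing rings,
    and the edges, where the clocks live. *)
Lemma pairP (Q : S * S -> Prop) : (forall x, Q (x, x)) ->
  (forall e : edge S, Q (val e)) -> forall p, Q p.
Proof.
move=> Qd Qe [x y]; have [->|xy] := eqVneq x y; first exact: Qd.
exact: (Qe (exist _ (x, y) xy)).
Qed.

Lemma rings_diag s t x : rings s t (x, x) = set0.
Proof. by apply/seteqP; split=> K //; rewrite /rings /= count_diag. Qed.

Lemma rings_edge s t e : rings s t (val e) = [set K | (K e s < K e t)%N].
Proof. by apply/funext => K; rewrite /rings /= count_edge. Qed.

Lemma rings_twice_edge s t e :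
  rings_twice s t (val e) = [set K | (K e s + 1 < K e t)%N].
Proof. by apply/funext => K; rewrite /rings_twice /= count_edge. Qed.

Lemma measurable_rings s t p : 0 <= s -> 0 <= t -> measurable (rings s t p).
Proof.
move=> s0 t0; elim/pairP : p => [x|e]; first by rewrite rings_diag.
by rewrite rings_edge; exact: (measurable_eval2 e (fun a b => (a < b)%N)).
Qed.

Lemma measurable_rings_twice s t p :
  0 <= s -> 0 <= t -> measurable (rings_twice s t p).
Proof.
move=> s0 t0; elim/pairP : p => [x|e]; last first.
  by rewrite rings_twice_edge; exact: (measurable_eval2 e (fun a b => (a + 1 < b)%N)).
rewrite (_ : rings_twice _ _ _ = set0)//.
by apply/seteqP; split=> K //; rewrite /rings_twice /= count_diag.
Qed.

Lemma P_rings s t p : 0 <= s -> s <= t ->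
  P (rings s t p) = (1 - expR (- (c p.1 p.2 * (t - s))))%:E.
Proof.
move=> s0 st; elim/pairP : p => [x|e]; last by rewrite rings_edge (P_hit c_ge0 P_poisson).
by rewrite rings_diag measure0/= c_diag mul0r oppr0 expR0 subrr.
Qed.

Lemma P_rings_le s t p : 0 <= s -> s <= t ->
  (P (rings s t p) <= (c p.1 p.2 * (t - s))%:E)%E.
Proof. by move=> s0 st; rewrite P_rings// lee_fin hit_prob_le. Qed.

Lemma P_rings_twice_le s t p : 0 <= s -> s <= t ->
  (P (rings_twice s t p) <= ((c p.1 p.2 * (t - s)) ^+ 2)%:E)%E.
Proof.
move=> s0 st; elim/pairP : p => [x|e]; last by rewrite rings_twice_edge (P_hit_twice c_ge0 P_poisson).
rewrite (_ : rings_twice _ _ _ = set0) ?measure0 ?lee_fin ?sqr_ge0//.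
by apply/seteqP; split=> K //; rewrite /rings_twice /= count_diag.
Qed.

Lemma P_rings2_le s t p q : p <> q -> 0 <= s -> s <= t ->
  (P (rings s t p `&` rings s t q) <=
   (c p.1 p.2 * (t - s) * (c q.1 q.2 * (t - s)))%:E)%E.
Proof.
move=> + s0 st; have t0 := le_trans s0 st; have ts : 0 <= t - s by rewrite subr_ge0.
elim/pairP : p => [x _|e].
  by rewrite rings_diag set0I measure0 lee_fin !mulr_ge0.
elim/pairP : q => [x _|e' ee'].
  by rewrite rings_diag setI0 measure0 lee_fin !mulr_ge0.
have {}ee' : e <> e' by move=> E; apply: ee'; rewrite E.
rewrite !rings_edge (P_independent2 P_poisson
  (fun a b => (a < b)%N) (fun a b => (a < b)%N) ee')//.
rewrite !(P_hit c_ge0 P_poisson)// EFinM lee_pmul//; rewrite lee_fin ?hit_prob_le//.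
- by rewrite hit_prob_ge0// mulr_ge0.
- by rewrite hit_prob_ge0// mulr_ge0.
Qed.

End pair_counts.

(** * Jumps of the clocks *)

Section jumps.
Context {R : realType} {S : countType}.
Variables (c : S -> S -> R) (c_ge0 : forall x y, 0 <= c x y).
Variables (P : probability (path_space R S) R) (P_poisson : poisson_family c P).
Implicit Types (e : edge S) (s t : R) (K : path_space R S).

Definition nondecreasing_paths : set (path_space R S) :=
  [set K | forall e, {homo (K e : R -> nat) : s t / s <= t >-> (s <= t)%N}].

(** Only countably many pairs of rational times have to be excluded. *)
Lemma ae_nondecreasing_paths : {ae P, forall K, nondecreasing_paths K}.
Proof.
apply: ae_countable => e.
have : {ae P, forall K, forall pq : rat * rat, 0 <= ratr pq.1 :> R ->
    ratr pq.1 <= ratr pq.2 :> R -> (K e (ratr pq.1) <= K e (ratr pq.2))%N}.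
  apply: ae_countable => -[p q] /=.
  have [p0|np0] := pselect (0 <= ratr p :> R); last by apply: aeW.
  have [pq|npq] := pselect (ratr p <= ratr q :> R); last by apply: aeW.
  have := ae_nondecreasing_at P_poisson e p0 pq.
  by apply: filterS.
apply: filterS => K H; apply: rat_nondecreasing => p q; exact: (H (p, q)).
Qed.

Let grid (T : R) n i : R := i%:R * (T / n.+1%:R).

Let grid_ge0 T n i : 0 <= T -> 0 <= grid T n i.
Proof. by move=> T0; rewrite mulr_ge0// divr_ge0. Qed.

Let grid_step T n i : grid T n i.+1 - grid T n i = T / n.+1%:R.
Proof. by rewrite /grid -mulrBl -natr1 addrAC subrr add0r mul1r. Qed.

Let grid_le T n i : 0 <= T -> grid T n i <= grid T n i.+1.
Proof. by move=> T0; rewrite -subr_ge0 grid_step divr_ge0. Qed.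

Let grid_cell T n s : 0 < s -> s <= T ->
  exists2 i, (i <= n)%N & grid T n i < s <= grid T n i.+1.
Proof.
move=> s0 sT.
have ex : exists m, s <= grid T n m.
  by exists n.+1; rewrite /grid mulrC divfK ?pnatr_eq0.
case: (ex_minnP ex) => -[|m] sm minm.
  by move: sm; rewrite /grid mul0r leNgt s0.
exists m.
  by rewrite -ltnS minm// /grid mulrC divfK ?pnatr_eq0.
rewrite sm andbT ltNge; apply/negP => /minm; by rewrite ltnn.
Qed.

(** Every grid sees the increment carried by a jump, in the cell that contains
    the jump time: the left limit dominates the value at the left end. *)
Let jump_cell K e T n s : nondecreasing_paths K -> 0 < s -> s <= T ->
  exists2 i, (i <= n)%N & ((K e (grid T n i) <= left_lim (K e) s) &&
   (K e s <= K e (grid T n i.+1)))%N.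
Proof.
move=> Kh s0 sT; have [i lin /andP[si is_]] := grid_cell n s0 sT.
exists i => //; rewrite (Kh e _ _ is_) andbT.
exact: (nondecreasing_left_lim (path_cadlag (K e)) (Kh e) si).
Qed.

Let jump_time_pos K e s : jump_time (K e) s -> 0 < s.
Proof.
move=> js; rewrite ltNge; apply/negP => s0; apply: js.
by rewrite left_lim_npos.
Qed.

Let jump_lt K e s : nondecreasing_paths K -> jump_time (K e) s ->
  (left_lim (K e) s < K e s)%N.
Proof.
move=> Kh js; rewrite ltn_neqAle left_lim_nondecreasing//; last exact: path_cadlag.
by rewrite andbT eq_sym; apply/eqP.
Qed.

(** A jump of size at least two puts two units into one cell of every grid, an
    event of probability at most (rate * mesh)^2 per cell. *)
Lemma ae_unit_jumps : {ae P, forall K, forall e s,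
  jump_time (K e) s -> K e s = (left_lim (K e) s).+1}.
Proof.
apply: ae_countable => e.
have : {ae P, forall K, forall N : nat, ~ forall n, exists2 i, (i <= n)%N &
    (K e (grid N%:R n i) + 1 < K e (grid N%:R n i.+1))%N}.
  apply: ae_countable => N.
  have := @grid_negligible _ _ _ P (fun n i => [set K : path_space R S |
    (K e (grid N%:R n i) + 1 < K e (grid N%:R n i.+1))%N])
    ((c (val e).1 (val e).2 * N%:R) ^+ 2).
  move=> /(_ _ _)/negligibleS; apply.
  - by move=> K /= /contrapT.
  - move=> n i; by apply: (measurable_eval2 e (fun a b => (a + 1 < b)%N)); exact: grid_ge0.
  - move=> n i; apply: le_trans (P_hit_twice c_ge0 P_poisson e _ _) _.
    + exact: grid_ge0.
    + exact: grid_le.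
    by rewrite grid_step lee_fin mulrA expr_div_n.
move: ae_nondecreasing_paths; apply: filterS2 => K Kh HK s js.
apply: contrapT => Ks.
apply: (HK (Num.truncn s).+1) => n.
have s0 := jump_time_pos js.
have [i lin /andP[h1 h2]] := jump_cell e n Kh s0 (ltW (truncnS_gt s)).
exists i => //; rewrite addn1; apply: (leq_trans _ h2).
apply: (@leq_ltn_trans (left_lim (K e) s).+1); first by rewrite ltnS.
by rewrite ltn_neqAle (jump_lt Kh js) andbT; apply/eqP => /esym.
Qed.

(** A common jump makes both clocks ring in one cell of every grid; by
    independence this has probability O(mesh^2) per cell. *)
Lemma ae_no_simultaneous_jumps : {ae P, forall K, forall e e' s, e <> e' ->
  jump_time (K e) s -> ~ jump_time (K e') s}.
Proof.
apply: ae_countable => e; apply: ae_countable => e'.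
have [->|/eqP ee'] := eqVneq e e'; first by apply: aeW => K s.
have : {ae P, forall K, forall N : nat, ~ forall n, exists2 i, (i <= n)%N &
    ((K e (grid N%:R n i) < K e (grid N%:R n i.+1))%N /\
     (K e' (grid N%:R n i) < K e' (grid N%:R n i.+1))%N)}.
  apply: ae_countable => N.
  have := @grid_negligible _ _ _ P (fun n i => [set K : path_space R S |
     (K e (grid N%:R n i) < K e (grid N%:R n i.+1))%N /\
     (K e' (grid N%:R n i) < K e' (grid N%:R n i.+1))%N])
    (c (val e).1 (val e).2 * N%:R * (c (val e').1 (val e').2 * N%:R)).
  move=> /(_ _ _)/negligibleS; apply.
  - by move=> K /= /contrapT.
  - move=> n i; apply: measurableI.
      by apply: (measurable_eval2 e (fun a b => (a < b)%N)); exact: grid_ge0.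
    by apply: (measurable_eval2 e' (fun a b => (a < b)%N)); exact: grid_ge0.
  - move=> n i; rewrite (P_independent2 P_poisson
      (fun a b => (a < b)%N) (fun a b => (a < b)%N) ee') ?grid_ge0//.
    rewrite !(P_hit c_ge0 P_poisson) ?grid_ge0 ?grid_le// grid_step -EFinM lee_fin.
    have r0 e0 : 0 <= c (val e0).1 (val e0).2 * (N%:R / n.+1%:R).
      by rewrite mulr_ge0// divr_ge0.
    rewrite (le_trans (ler_pM _ _ (hit_prob_le _) (hit_prob_le _)))//.
    + exact: hit_prob_ge0.
    + exact: hit_prob_ge0.
    have : (n.+1%:R != 0 :> R) by rewrite pnatr_eq0.
    by move: (n.+1%:R) => m m0; rewrite le_eqVlt; apply/orP; left; apply/eqP; field.
move: ae_nondecreasing_paths; apply: filterS2 => K Kh HK s _ js js'.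
apply: (HK (Num.truncn s).+1) => n.
have s0 := jump_time_pos js.
have [i lin /andP[si is_]] := grid_cell n s0 (ltW (truncnS_gt s)).
have h e0 := nondecreasing_left_lim (path_cadlag (K e0)) (Kh e0) si.
exists i => //; split.
  by rewrite (leq_ltn_trans (h e))// (leq_trans (jump_lt Kh js))// Kh.
by rewrite (leq_ltn_trans (h e'))// (leq_trans (jump_lt Kh js'))// Kh.
Qed.

End jumps.

(** * Random graphs of open pairs *)

Section percolation.
Context {S : countType}.
Implicit Types (w : edge S -> bool).

Definition open_pair w (p : S * S) : bool :=
  if insub p is Some e then w e else false.

Definition open_graph w : rel S := fun x y =>
  open_pair w (x, y) || open_pair w (y, x).

Definition open_component w (x : S) : set S :=
  [set y | exists2 p : seq S, path (open_graph w) x p & y = last x p].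

(** Stable under intersection and generating; the law of a family of independent
    events is thus determined by the probabilities of these cylinders. *)
Definition all_open : set (set (edge S -> bool)) :=
  [set [set w : edge S -> bool | forall e, e \in F -> w e] | F in [set: {fset edge S}]].

Definition edge_configs := g_sigma_algebraType all_open.

Lemma all_openI : setI_closed all_open.
Proof.
move=> _ _ [F _ <-] [G _ <-]; exists (F `|` G)%fset => //.
apply/seteqP; split=> w /=.
  by move=> H; split=> e eF; apply: H; rewrite inE eF ?orbT.
by move=> [HF HG] e; rewrite inE => /orP[/HF|/HG].
Qed.

Lemma measurable_open (e : edge S) : measurable ([set w : edge S -> bool | w e] : set edge_configs).
Proof.
apply: sub_sigma_algebra; exists [fset e]%fset => //.
apply/seteqP; split=> w /=; first by apply; rewrite inE.
by move=> we e'; rewrite inE => /eqP ->.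
Qed.

Lemma measurable_open_graph x y :
  measurable ([set w : edge S -> bool | open_graph w x y] : set edge_configs).
Proof.
have mopen p : measurable ([set w : edge S -> bool | open_pair w p] : set edge_configs).
  rewrite /open_pair; case: insub => [e|]; first exact: measurable_open.
  by rewrite [X in measurable X](_ : _ = set0)//; apply: funext => w; apply: propext; split.
rewrite [X in measurable X](_ : _ = [set w : edge S -> bool | open_pair w (x, y)] `|`
   [set w : edge S -> bool | open_pair w (y, x)]).
  exact: measurableU.
by apply/seteqP; split=> w /orP.
Qed.

Lemma measurable_open_path x p :
  measurable ([set w : edge S -> bool | path (open_graph w) x p] : set edge_configs).
Proof.
elim: p x => [|y p IHp] x /=.
  by rewrite [X in measurable X](_ : _ = setT)//; apply: funext => w; apply: propext; split.
rewrite [X in measurable X](_ : _ = [set w : edge S -> bool | open_graph w x y] `&`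
  [set w : edge S -> bool | path (open_graph w) y p]).
  by apply: measurableI; [exact: measurable_open_graph|exact: IHp].
by apply/seteqP; split=> w /= /andP.
Qed.

Lemma measurable_open_component x y :
  measurable ([set w : edge S -> bool | open_component w x y] : set edge_configs).
Proof.
rewrite [X in measurable X](_ : _ = [set w : edge S -> bool | exists p : seq S,
    ([set w : edge S -> bool | path (open_graph w) x p] `&` [set w : edge S -> bool | y = last x p]) w]).
  apply: countable_exists_measurable => p; apply: measurableI.
    exact: measurable_open_path.
  have [yp|yp] := pselect (y = last x p).
    by rewrite [X in measurable X](_ : _ = setT)//; apply: funext => w; apply: propext; split.
  by rewrite [X in measurable X](_ : _ = set0)//; apply/seteqP; split.
by apply/seteqP; split=> w /= [p]; [exists p|case; exists p].
Qed.

Lemma finite_set_seq (T : choiceType) (A : set T) :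
  finite_set A <-> exists s : seq T, forall y, A y -> y \in s.
Proof.
split=> [/finite_seqP[s ->]|[s As]]; first by exists s.
by apply: (@sub_finite_set _ _ [set` s]) => //; exact: finite_seq.
Qed.

Lemma measurable_finite_open_components :
  measurable ([set w : edge S -> bool | forall x, finite_set (open_component w x)] : set edge_configs).
Proof.
rewrite [X in measurable X](_ : _ = [set w : edge S -> bool | forall x, exists s : seq S, forall y,
    [set w : edge S -> bool | open_component w x y -> y \in s] w]).
  apply: countable_forall_measurable => x; apply: countable_exists_measurable => s.
  apply: countable_forall_measurable => y.
  have [ys|/negP ys] := boolP (y \in s).
    by rewrite [X in measurable X](_ : _ = setT)//; apply: funext => w; apply: propext; split.
  rewrite [X in measurable X](_ : _ = ~` [set w : edge S -> bool | open_component w x y]).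
    by apply: measurableC; exact: measurable_open_component.
  by apply: funext => w; apply: propext; split=> /= H /H.
by apply/seteqP; split=> w /= H x; apply/finite_set_seq; exact: H.
Qed.

End percolation.

(** * Graphs of the time windows and total rates *)

Section window_graphs.
Context {R : realType} {S : countType}.
Variables (c : S -> S -> R) (c_ge0 : forall x y, 0 <= c x y).
Variables (P : probability (path_space R S) R) (P_poisson : poisson_family c P).
Variables (t0 : R) (t0_gt0 : 0 < t0).
Hypothesis SEP : {ae P, forall K, finite_components t0 0 K}.

Let SEP' : {ae P, forall K : path_space R S, finite_components t0 0 K}.
Proof. exact: SEP. Qed.

Definition window_edges (r : nat) (K : path_space R S) : edge_configs :=
  fun e => (K e (r%:R * t0)%R < K e (r.+1%:R * t0)%R)%N.

Let time_ge0 r : 0 <= r%:R * t0.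
Proof. by rewrite mulr_ge0// ltW. Qed.

Let time_le r : r%:R * t0 <= r.+1%:R * t0.
Proof. by rewrite ler_pM2r// ler_nat. Qed.

(** Monotonicity makes the symmetrized count increase as soon as one of the two
    clocks rings. *)
Lemma graph_window r (K : path_space R S) : nondecreasing_paths K ->
  graph t0 K r = open_graph (window_edges r K) :> rel S.
Proof.
move=> Kh; apply/funext => x; apply/funext => y; rewrite /graph /= /open_graph /open_pair.
have [->|xy] /= := eqVneq x y; first by rewrite insubF//= eqxx.
rewrite /count_sym /Defs.count.
have yx : y != x by rewrite eq_sym.
rewrite !(@insubT _ (fun p : S * S => p.1 != p.2) _ (x, y) xy).
rewrite !(@insubT _ (fun p : S * S => p.1 != p.2) _ (y, x) yx) /=.
rewrite /window_edges; set e := Sub _ _; set e' := Sub _ _.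
have := Kh e _ _ (time_le r); have := Kh e' _ _ (time_le r).
lia.
Qed.

Lemma component_window r (K : path_space R S) x : nondecreasing_paths K ->
  component t0 K r x = open_component (window_edges r K) x.
Proof. by move=> Kh; rewrite /component graph_window. Qed.

Lemma measurable_window_edges r : measurable_fun setT (window_edges r).
Proof.
apply: measurability; first by [].
move=> _ [_ [F _ <-] <-]; rewrite setTI.
rewrite (_ : _ @^-1` _ = [set K : path_space R S | forall e, [set K | e \in F ->
    (K e (r%:R * t0)%R < K e (r.+1%:R * t0)%R)%N] K])//.
apply: countable_forall_measurable => e; have [eF|/negP eF] := boolP (e \in F).
  rewrite [X in measurable X](_ : _ =
      [set K : path_space R S | (K e (r%:R * t0)%R < K e (r.+1%:R * t0)%R)%N]).
    exact: (measurable_eval2 e (fun a b => (a < b)%N)).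
  by apply: funext => K; apply: propext; split=> /=; [apply|].
by rewrite [X in measurable X](_ : _ = setT)//; apply: funext => w; apply: propext; split.
Qed.

(** The increments over windows of equal length have the same law, and are
    independent over the pairs: all window graphs have the law of the first. *)
Lemma window_edges_law r (A : set edge_configs) : measurable A ->
  P (window_edges r @^-1` A) = P (window_edges 0 @^-1` A).
Proof.
apply: (@measure_unique _ R edge_configs all_open (fun=> setT) _ _ _ _
  (pushforward P (window_edges r)) (pushforward P (window_edges 0))).
- by [].
- exact: all_openI.
- by move=> _; exists fset0 => //; apply/seteqP; split=> w //= _ e; rewrite inE.
- by rewrite bigcup_const//; exists 0%N.
- exact: measurable_window_edges.
- exact: measurable_window_edges.
- move=> mr m0 _ [F _ <-]; rewrite /pushforward /=.
  have PF m : P (window_edges m @^-1` [set w : edge S -> bool | forall e, e \in F -> w e]) =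
      (\prod_(e <- F) (1 - expR (- (c (val e).1 (val e).2 * t0)))%:E)%E.
    rewrite (P_all_hit c_ge0 P_poisson F (time_ge0 m) (time_le m)).
    by apply: eq_bigr => e _; rewrite -mulrBl -natr1 addrAC subrr add0r mul1r.
  exact: etrans (PF r) (esym (PF 0%N)).
- move=> mr _; rewrite /pushforward /=; apply: (@le_lt_trans _ _ 1%E); last by rewrite ltry.
  exact: (probability_le1 P measurableT).
Qed.

Lemma ae_finite_components : {ae P, forall K, forall r, finite_components t0 r K}.
Proof.
apply: ae_countable => r.
pose B : set edge_configs := [set w : edge S -> bool | forall x, finite_set (open_component w x)].
have mB : measurable B by exact: measurable_finite_open_components.
have mX m : measurable (window_edges m @^-1` B).
  by rewrite -[X in measurable X]setTI; exact: measurable_window_edges.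
have mP m : P (~` (window_edges m @^-1` B)) = P (~` (window_edges 0 @^-1` B)).
  by apply: (@window_edges_law m (~` B)); exact: measurableC.
have B0 : P (~` (window_edges 0 @^-1` B)) = 0%E.
  apply/negligibleP; first exact: measurableC.
  have : {ae P, forall K, (window_edges 0 @^-1` B) K}; last by [].
  apply: (ae_imply2 _ SEP' (ae_nondecreasing_paths P_poisson)) => K fK Kh x.
  rewrite -component_window//; exact: fK.
have aeB : {ae P, forall K, (window_edges r @^-1` B) K}.
  rewrite /almost_everywhere; apply/negligibleP; last exact: etrans (mP r) B0.
  exact: measurableC (mX r).
apply: (ae_imply2 _ (ae_nondecreasing_paths P_poisson) aeB) => K Kh BK x.
by rewrite component_window//; exact: BK.
Qed.

(** Second Borel-Cantelli argument: with positive probability the neighbours of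
    x in the first window lie in a fixed finite set, and this probability is at
    most exp (- t0 * rate) for the total rate of any finitely many pairs that
    this event forbids to ring. *)
Lemma total_rate_fin x : (total_rate c x < +oo)%E.
Proof.
pose E (s : seq S) : set (path_space R S) := window_edges 0 @^-1`
  [set w : edge S -> bool | forall y, y \notin s -> ~ open_graph w x y].
have mE s : measurable (E s).
  rewrite -[X in measurable X]setTI; apply: measurable_window_edges => //.
  apply: countable_forall_measurable => y.
  have [ys|ys] := boolP (y \in s).
    by rewrite [X in measurable X](_ : _ = setT)//; apply: funext => w; apply: propext; split.
  rewrite [X in measurable X](_ : _ = ~` [set w : edge S -> bool | open_graph w x y]).
    by apply: measurableC; exact: measurable_open_graph.
  by apply: funext => w; apply: propext; split=> /=; [apply|].
have [s Es0] : exists s, P (E s) != 0%E.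
  apply: contrapT => nE.
  have : P.-negligible (\bigcup_s E s).
    apply: negligible_countable => s; apply/negligibleP => //.
    by apply: contrapT => /eqP Es; apply: nE; exists s.
  have cover : {ae P, forall K, (\bigcup_s E s) K}.
    apply: (ae_imply2 _ SEP' (ae_nondecreasing_paths P_poisson)) => K fK Kh.
    have /finite_set_seq[s Hs] := fK x.
    exists s => // y ys oy; move/negP : ys; apply; apply: Hs.
    rewrite component_window//; exists [:: y] => //=.
    by rewrite andbT.
  move=> N; have : P.-negligible setT.
    by rewrite -(setUv (\bigcup_s E s)); exact: negligibleU.
  move=> /(negligibleP P measurableT) PT.
  by have := probability_setT P; rewrite [X in X = _]PT => -[/eqP]; rewrite eq_sym oner_eq0.
have Es_gt0 : 0 < fine (P (E s)).
  by rewrite fine_gt0// lt0e Es0 measure_ge0/= (le_lt_trans (probability_le1 _ (mE s)))// ltry.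
have PEs : P (E s) = (fine (P (E s)))%:E by rewrite fineK// fin_num_measure.
(* The event E s forbids every pair of B to ring in the first window; by
   independence, a finite part of B with total rate r gives
   P (E s) <= exp (- r * t0), hence r <= M. *)
pose M := - ln (fine (P (E s))) / t0.
pose B : set (edge S) := [set e | ((val e).1 = x /\ (val e).2 \notin s) \/
  ((val e).2 = x /\ (val e).1 \notin s)].
have rateB (F : {fset edge S}) : [set` F] `<=` B ->
    \sum_(e <- F) c (val e).1 (val e).2 <= M.
  move=> FB; rewrite ler_pdivlMr// lerNr -ler_expR lnK ?posrE//.
  rewrite -lee_fin -PEs.
  have := P_none_hit c_ge0 P_poisson F (time_ge0 0) (time_le 0).
  under eq_bigr do rewrite mul0r subr0 mul1r.
  rewrite -mulr_suml => <-; apply: le_measure; rewrite ?inE//.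
    apply: (@countable_forall_measurable _ _ _
      (fun e => [set K : path_space R S | e \in F ->
         ~ (K e (0%:R * t0)%R < K e (1%:R * t0)%R)%N])) => e.
    have [eF|eF] := boolP (e \in F); last first.
      by rewrite [X in measurable X](_ : _ = setT)//; apply: funext => w; apply: propext; split.
    rewrite [X in measurable X](_ : _ = [set K : path_space R S |
       ~ (K e (0%:R * t0)%R < K e (1%:R * t0)%R)%N]).
      exact: (measurable_eval2 e (fun a b => ~ (a < b)%N)).
    by apply: funext => w; apply: propext; split=> /=; [apply|].
  move=> K EK e eF; have := FB _ eF; rewrite /E /= in EK.
  have opn : (K e (0%:R * t0)%R < K e (1%:R * t0)%R)%N ->
      open_pair (window_edges 0 K) (val e).
    by rewrite /open_pair valK.
  move=> [[ex es]|[ex es]] H.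
    apply: (EK _ es); rewrite /open_graph -ex -surjective_pairing.
    by apply/orP; left; exact: opn.
  apply: (EK _ es); rewrite /open_graph -ex -surjective_pairing.
  by apply/orP; right; exact: opn.
have half (h : S -> S * S) : injective h ->
    (forall y, y != x -> y \notin s -> exists2 e, B e & val e = h y) ->
    (forall y, y != x -> (h y).1 != (h y).2) ->
    (\esum_(y in [set y | y \notin x :: s]) (c (h y).1 (h y).2)%:E <= M%:E)%E.
  move=> hi hB hd.
  pose Q := [set e : edge S | exists2 y, y \notin x :: s & val e = h y].
  rewrite -(esum_image _ h (fun p : S * S => (c p.1 p.2)%:E)); last first.
    by move=> y y' _ _; exact: hi.
  rewrite (reindex_esum Q _ (val : edge S -> S * S)); last first.
    split.
    - by move=> e [y ys ey] /=; exists y.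
    - by move=> e e' _ _; exact: val_inj.
    - move=> _ [y ys <-]; have : y \notin x :: s by []; rewrite inE negb_or => /andP[yx _].
      by exists (exist _ (h y) (hd _ yx)) => //; exists y.
  apply: ge_ereal_sup => _ [X [finX XQ] <-].
  rewrite fsbig_finite//= sumEFin lee_fin; apply: rateB => e.
  rewrite /= in_fset_set// inE => /XQ[y]; rewrite inE negb_or => /andP[yx ys] ey.
  by have [e' Be' e'y] := hB y yx ys; rewrite (val_inj (etrans ey (esym e'y))).
have h1 := half (fun y => (x, y)); have h2 := half (fun y => (y, x)).
rewrite /total_rate (esumID [set` x :: s])//; last first.
  by move=> y _; rewrite lee_fin addr_ge0.
rewrite !setTI lte_add_pinfty//.
  rewrite esum_fset; [|exact: finite_seq|by move=> y _; rewrite lee_fin addr_ge0].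
  by rewrite fsbig_finite//= sumEFin ltry.
rewrite [X in esum X](_ : _ = [set y | y \notin x :: s]); last first.
  by apply/seteqP; split=> y /= /negP.
under eq_esum do rewrite EFinD.
rewrite esumD; [|by move=> *; rewrite lee_fin..].
apply: (@le_lt_trans _ _ (M%:E + M%:E)%E); last by rewrite ltry.
apply: leeD.
  apply: h1 => [y y' [] //|y yx ys|y yx]; last by rewrite eq_sym.
  have xy : x != y by rewrite eq_sym.
  by exists (exist _ (x, y) xy) => //; left.
apply: h2 => [y y' [] //|y yx ys|y yx //].
by exists (exist _ (y, x) yx) => //; right.
Qed.

Hypothesis c_diag : forall x, c x x = 0.

(** The means of the counts at a site sum to a multiple of its total rate, so
    that almost surely only finitely many of them are positive. *)
Lemma ae_finite_counts : {ae P, forall K, forall x t, 0 <= t ->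
  (\esum_(y in [set~ x]) (count_sym K x y t)%:R%:E < +oo :> \bar R)%E}.
Proof.
apply: ae_countable => x.
have fin_rings (h : S -> S * S) : (forall y, c (h y).1 (h y).2 <= c x y + c y x) ->
    {ae P, forall K, forall N : nat, finite_set [set y | rings 0 N%:R (h y) K]}.
  move=> hc; apply: ae_countable => N.
  apply: (ae_finitely_many (A := fun y => rings 0 N%:R (h y))).
    by move=> y; exact: measurable_rings.
  apply: (@le_lt_trans _ _ (total_rate c x * N%:R%:E)%E); last first.
    have r0 : (0 <= total_rate c x)%E.
      by apply: esum_ge0 => y _; rewrite lee_fin addr_ge0.
    by rewrite lte_mul_pinfty ?ge0_fin_numE ?total_rate_fin ?ltry.
  apply: le_trans (esum_wpM2r _ _ _); first last.
  - by rewrite lee_fin.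
  - by move=> y; rewrite lee_fin addr_ge0.
  apply: le_esum => y _; rewrite (le_trans (P_rings_le c_ge0 c_diag P_poisson _ _ _))//.
  by rewrite -EFinM subr0 lee_fin ler_wpM2r.
have H1 := fin_rings (fun y => (x, y)); have H2 := fin_rings (fun y => (y, x)).
have {}H1 := H1 (fun y => ltac:(by rewrite lerDl)).
have {}H2 := H2 (fun y => ltac:(by rewrite lerDr)).
have H3 : {ae P, forall K : path_space R S, forall e : edge S, K e 0 = 0%N}.
  by apply: ae_countable => e; exact: (ae_start0 P_poisson).
have Hh := ae_nondecreasing_paths P_poisson.
apply: (ae_imply2 _ (ae_conj H1 H2) (ae_conj H3 Hh)) => K [f1 f2] [K0 Kh] t t_ge0.
have countK y z : (Defs.count K y z t <= Defs.count K y z (Num.truncn t).+1%:R)%N.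
  rewrite /Defs.count; case: insub => // e; apply: Kh; exact: ltW (truncnS_gt _).
have count0 y z : Defs.count K y z 0 = 0%N.
  by rewrite /Defs.count; case: insub => // e; rewrite K0.
set N := (Num.truncn t).+1 in countK.
pose Y := [set y | rings 0 N%:R (x, y) K] `|` [set y | rings 0 N%:R (y, x) K].
have finY : finite_set Y by rewrite finite_setU.
rewrite (esumID Y)//.
rewrite [X in (_ + X)%E]esum1 ?adde0; last first.
  move=> y [_ nY]; suff -> : count_sym K x y t = 0%N by [].
  apply/eqP; rewrite /count_sym addn_eq0.
  apply/andP; split; rewrite -leqn0 leqNgt; apply/negP => H; apply: nY.
    by left; rewrite /rings /= count0 (leq_trans H).
  by right; rewrite /rings /= count0 (leq_trans H).
rewrite esum_fset; [|exact: finite_setIr|by move=> y _; rewrite lee_fin].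
by rewrite fsbig_finite ?sumEFin ?ltry//; exact: finite_setIr.
Qed.

(** Monotonicity of all clocks is kept along with Gamma_star: it is what turns
    jumps into increments in the analysis of the graphical construction. *)
Lemma ae_Gamma_star : {ae P, forall K, Gamma_star t0 K /\ nondecreasing_paths K}.
Proof.
have H1 := ae_finite_components; have H2 := ae_finite_counts.
have H3 := ae_no_simultaneous_jumps c_ge0 P_poisson.
have H4 := ae_unit_jumps c_ge0 P_poisson.
have H5 : {ae P, forall K : path_space R S, forall e : edge S, K e 0 = 0%N}.
  by apply: ae_countable => e; exact: (ae_start0 P_poisson).
have H6 := ae_nondecreasing_paths P_poisson.
apply: (ae_imply2 _ (ae_conj H1 H2) (ae_conj (ae_conj H3 H4) (ae_conj H5 H6))).
by move=> K [K1 K2] [[K3 K4] [K5 K6]]; split.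
Qed.

End window_graphs.

(** * The graphical construction over a short time *)

Section jump_structure.
Context {R : realType}.
Implicit Types (w : @cadlag_path R nat) (s t : R).

(** The first time at which the path exceeds its initial value is attained by
    right continuity, and is a jump since the path is constant before it. *)
Lemma cadlag_jump_exists w t : {homo (w : R -> nat) : a b / a <= b >-> (a <= b)%N} ->
  0 <= t -> (w 0%R < w t)%N -> exists s, [/\ 0 < s, s <= t & jump_time w s].
Proof.
move=> wh t_ge0 w0t; pose A := [set u : R | 0 <= u /\ (w 0%R < w u)%N].
have At : A t by [].
have hA : has_inf A by split; [exists t|exists 0 => u []].
have [d d0 wd] := cadlag_right 0 (path_cadlag w).
have infd : d <= inf A.
  apply: lb_le_inf; first by exists t.
  move=> u [u0 wu]; rewrite leNgt; apply/negP => ud.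
  by move: wu; rewrite (wd u) ?ltnn// add0r u0.
have inf0 : 0 < inf A by exact: lt_le_trans infd.
have ws : (w 0%R < w (inf A))%N.
  rewrite ltnNge; apply/negP => ws.
  have [d' d'0 wd'] := cadlag_right (inf A) (path_cadlag w).
  have [u [u0 wu] ud'] := inf_adherent d'0 hA.
  have iu : inf A <= u by apply: ge_inf => //; case: hA.
  by move: wu; rewrite (wd' u) ?iu//= ltnNge ws.
exists (inf A); split => //; first by apply: ge_inf => //; case: hA.
have [d' d'0 wd'] := cadlag_left (inf A) (path_cadlag w).
pose u := Num.max 0 (inf A - d' / 2).
have ui : u < inf A by rewrite gt_max inf0/= ltrBlDr ltrDl divr_gt0.
have u0 : 0 <= u by rewrite le_max lexx.
rewrite /jump_time -(wd' u); last first.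
  rewrite ui andbT lt_max; apply/orP; right.
  by rewrite ltrD2l ltrN2 ltr_pdivrMr// ltr_pMr// ltr1n.
move=> E; have : A u by split => //; rewrite -E.
by move/(ge_inf (proj2 hA)); rewrite leNgt ui.
Qed.

(** A non-decreasing path takes different values at different jump times, all of
    them at most its value at t. *)
Lemma finite_jump_times w t : {homo (w : R -> nat) : a b / a <= b >-> (a <= b)%N} ->
  finite_set [set s | s <= t /\ jump_time w s].
Proof.
move=> wh.
have jlt s : jump_time w s -> (left_lim w s < w s)%N.
  move=> js; rewrite ltn_neqAle left_lim_nondecreasing ?andbT//; last exact: path_cadlag.
  by rewrite eq_sym; apply/eqP.
have winj : {in [set s | s <= t /\ jump_time w s] &, injective (w : R -> nat)}.
  move=> s s'; rewrite !inE => -[_ js] [_ js'] E.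
  have [ss'|s's|//] := ltgtP s s'.
    have := jlt _ js'; have := nondecreasing_left_lim (path_cadlag w) wh ss'.
    by rewrite E => h1 h2; have := leq_ltn_trans h1 h2; rewrite ltnn.
  have := jlt _ js; have := nondecreasing_left_lim (path_cadlag w) wh s's.
  by rewrite E => h1 h2; have := leq_ltn_trans h1 h2; rewrite ltnn.
rewrite -(eq_finite_set (inj_card_eq winj)).
apply: (@sub_finite_set _ _ `I_(w t).+1) => //.
by move=> _ [s [st _] <-] /=; rewrite ltnS wh.
Qed.

End jump_structure.

Section graphical_construction.
Context {R : realType} {S : countType}.
Variables (t0 : R) (t0_gt0 : 0 < t0) (t : R) (t_gt0 : 0 < t) (t_lt : t < t0).
Variable (K : path_space R S).
Hypotheses (K_Gamma : Gamma_star t0 K) (K_nd : nondecreasing_paths K).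
Implicit Types (sigma xi : config S) (x y z : S) (s : R).

Let count_nd x y : {homo (Defs.count K x y : R -> nat) : a b / a <= b >-> (a <= b)%N}.
Proof. by move=> a b ab; rewrite /Defs.count; case: insub => // e; exact: K_nd. Qed.

Let edge_of x y (xy : x <> y) : edge S := exist _ (x, y) (introN eqP xy).

Let countE x y (xy : x <> y) : Defs.count K x y = K (edge_of xy) :> (R -> nat).
Proof. exact: (count_edge K (edge_of xy)). Qed.

Let jumpE x y s (xy : x <> y) : jump K x y s <-> jump_time (K (edge_of xy)) s.
Proof.
have [_ _ [_ K1] _] := K_Gamma.
rewrite /jump countE; split; last exact: K1.
by rewrite /jump_time => ->; apply/eqP; rewrite gtn_eqF.
Qed.

Let jump_pos x y s : x <> y -> jump K x y s -> 0 < s.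
Proof.
move=> xy /(jumpE _ xy) js; rewrite ltNge; apply/negP => s0; apply: js.
by rewrite left_lim_npos.
Qed.

Let jump_incr x y s a u : x <> y -> jump K x y s -> a < s -> s <= u ->
  (Defs.count K x y a < Defs.count K x y u)%N.
Proof.
move=> xy js as_ su; apply: (@leq_trans (Defs.count K x y s)); last exact: count_nd.
rewrite js ltnS countE; apply: nondecreasing_left_lim => //; exact: path_cadlag.
Qed.

Let jump_rings x y s : x <> y -> jump K x y s -> s <= t -> rings 0 t (x, y) K.
Proof. by move=> xy js st; apply: jump_incr xy js (jump_pos xy js) st. Qed.

Let times C := sort <=%R (fset_set (jump_times t0 K 0 C t)).

Let finite_jump_times_component x :
  finite_set (jump_times t0 K 0 (component t0 K 0 x) t).
Proof.
have [/(_ 0%N x) finC _ _ _] := K_Gamma; set C := component t0 K 0 x in finC *.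
apply: (@sub_finite_set _ _ (\bigcup_(p in (C `*` C) `&` [set p | p.1 <> p.2])
    [set s | s <= t /\ jump K p.1 p.2 s])).
  move=> s [/andP[_ st] [y [z [Cy Cz yz js]]]].
  by exists (y, z).
apply: bigcup_finite; first by apply: finite_setIl; exact: finite_setX.
move=> [y z] [_ /= yz].
apply: sub_finite_set (finite_jump_times (w := K (edge_of yz)) t (K_nd (edge_of yz))).
by move=> s [st js]; split => //; exact/jumpE.
Qed.

Let mem_times x s : s \in times (component t0 K 0 x) <->
  [/\ 0 < s, s <= t & exists y z, [/\ component t0 K 0 x y, component t0 K 0 x z,
     y <> z & jump K y z s] ].
Proof.
rewrite mem_sort in_fset_set; last exact: finite_jump_times_component.
rewrite inE /jump_times /= mul0r; split; first by move=> [/andP[]].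
by move=> [-> ->].
Qed.

Let eta_first_window sigma x : Defs.eta t0 K sigma t x =
  foldl (fun xi s => update K (component t0 K 0 x) s xi) sigma
    (times (component t0 K 0 x)) x.
Proof.
rewrite /Defs.eta.
have -> : Num.truncn (t / t0) = 0%N; last by [].
by apply: truncn_def; rewrite divr_ge0 ?ltW//= ltr_pdivrMr// mul1r.
Qed.

Let still s z := forall x y, x <> y -> jump K x y s -> x <> z /\ y <> z.

Let update_still C s xi z : still s z -> update K C s xi z = xi z.
Proof.
move=> sz; rewrite /update; case: asboolP => [[y [_ zy js _]]|_].
  by have [] := sz _ _ zy js.
by case: asboolP => // -[x [_ xz js _]]; have [] := sz _ _ xz js.
Qed.

Let foldl_still C l xi z : (forall s, s \in l -> still s z) ->
  foldl (fun xi s => update K C s xi) xi l z = xi z.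
Proof.
elim: l xi => //= s l IHl xi H; rewrite IHl.
  by apply: update_still; apply: H; rewrite inE eqxx.
by move=> s' s'l; apply: H; rewrite inE s'l orbT.
Qed.

(** Each update is triggered by a jump up to time t, hence by a ringing pair, and
    only changes the two sites of that pair. *)
Lemma eta_untouched sigma z :
  (forall p : S * S, p.1 = z \/ p.2 = z -> ~ rings 0 t p K) ->
  Defs.eta t0 K sigma t z = sigma z.
Proof.
move=> nz; rewrite eta_first_window; apply: foldl_still => s /mem_times[_ st _].
move=> x y xy js; have r := jump_rings xy js st.
by split=> E; apply: (nz (x, y)) => //=; [left|right].
Qed.

Definition attempt sigma (p : S * S) : config S :=
  if sigma p.1 && ~~ sigma p.2 then exchange sigma p.1 p.2 else sigma.

Let component_refl x : component t0 K 0 x x.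
Proof. by exists [::]. Qed.

(** The component is computed from the whole first window, which contains the
    rings up to time t. *)
Let component_neighbour x y : x <> y -> rings 0 t (x, y) K \/ rings 0 t (y, x) K ->
  component t0 K 0 x y.
Proof.
move=> xy r; exists [:: y] => //=; rewrite andbT; apply/andP; split; first exact/eqP.
rewrite mul0r mul1r /count_sym.
have h a b : (Defs.count K a b t <= Defs.count K a b t0)%N by apply: count_nd; exact: ltW.
have h0 a b : (Defs.count K a b 0 <= Defs.count K a b t0)%N by apply: count_nd; exact: ltW.
have := h x y; have := h y x; have := h0 x y; have := h0 y x.
have {}r : (Defs.count K x y 0 < Defs.count K x y t)%N \/
  (Defs.count K y x 0 < Defs.count K y x t)%N := r.
move: (Defs.count K x y 0) (Defs.count K x y t) (Defs.count K x y t0) r.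
move: (Defs.count K y x 0) (Defs.count K y x t) (Defs.count K y x t0).
by move=> a1 a2 a3 b1 b2 b3; lia.
Qed.

(** The list of updates of the component contains the unique jump time s of the
    pair (x, y) exactly once; the updates before and after it leave x and y
    unchanged, and at time s no other pair meeting x or y can move a particle. *)
Lemma eta_single sigma x y : x <> y -> rings 0 t (x, y) K ->
  ~ rings_twice 0 t (x, y) K ->
  (forall q : S * S, q <> (x, y) ->
     [\/ q.1 = x, q.2 = x, q.1 = y | q.2 = y] -> ~ rings 0 t q K) ->
  forall z, z = x \/ z = y -> Defs.eta t0 K sigma t z = attempt sigma (x, y) z.
Proof.
move=> xy rxy nrxy nq z zxy.
have [s [s0 st js]] : exists s, [/\ 0 < s, s <= t & jump K x y s].
  have := rxy; rewrite /rings /= countE => /(cadlag_jump_exists (K_nd _) (ltW t_gt0)).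
  by move=> [s [s0 st /jumpE js]]; exists s.
(* The only jump up to time t of a pair that meets x or y is that of (x, y) at
   s: a second jump would make this pair ring twice. *)
have only a b u : a <> b -> jump K a b u -> u <= t ->
    [\/ a = x, b = x, a = y | b = y] -> (a, b) = (x, y) /\ u = s.
  move=> ab ju ut touch; have r := jump_rings ab ju ut.
  have [E|/eqP abxy] := eqVneq (a, b) (x, y); last first.
    by exfalso; apply: (nq _ abxy touch r).
  split=> //; case: E ab ju r touch => -> -> ab ju _ _.
  apply: contrapT => us; apply: nrxy; rewrite /rings_twice /= addn1.
  have u0 := jump_pos ab ju.
  have [us'|su|//] := ltgtP u s.
    exact: leq_ltn_trans (jump_incr ab ju u0 (lexx u)) (jump_incr ab js us' st).
  exact: leq_ltn_trans (jump_incr ab js s0 (lexx s)) (jump_incr ab ju su ut).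
have quiet u a : u <= t -> u <> s -> a = x \/ a = y -> still u a.
  move=> ut us axy b b' bb' ju; split=> E; apply: us;
    (apply: proj2 (only _ _ _ bb' ju ut _); case: axy => <-; rewrite E;
     [by constructor|by constructor]).
rewrite eta_first_window; set C := component t0 K 0 z.
have [Cx Cy] : C x /\ C y.
  case: zxy => zE; rewrite /C zE; split; do ?exact: component_refl.
    by apply: component_neighbour => //; left.
  by apply: component_neighbour; [exact/nesym|right].
have sl : s \in times C by apply/mem_times; split => //; exists x, y.
have ul : uniq (times C) by rewrite sort_uniq fset_uniq.
have lt u : u \in times C -> u <= t by move=> /mem_times[].
move: sl ul lt; case/splitPr: (times C) / => l1 l2; rewrite cat_uniq /=.
move=> /and3P[_ /norP[sl1 _] /andP[sl2 _]] lt.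
rewrite foldl_cat /=; set xi := foldl _ sigma l1.
have xiE a : a = x \/ a = y -> xi a = sigma a.
  move=> axy; apply: foldl_still => u ul1; apply: quiet => //.
    by apply: lt; rewrite mem_cat ul1.
  by move=> us; move: sl1; rewrite -us ul1.
rewrite foldl_still; last first.
  move=> u ul2; apply: quiet => //.
    by apply: lt; rewrite mem_cat inE ul2 !orbT.
  by move=> us; move: sl2; rewrite -us ul2.
(* At time s a move that involves z can only be the move from x to y. *)
have mv a b : moves K C s xi a b -> a = z \/ b = z ->
    [/\ a = x, b = y & sigma x && ~~ sigma y].
  move=> [_ ab jab occ] abz.
  have [|[ax by_] _] := only a b s ab jab st.
    by case: abz => ->; case: zxy => ->; [constructor|constructor|constructor|constructor].
  by move: occ; rewrite ax by_ !xiE//; [right|left].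
rewrite /update /attempt /=; case: asboolP => [[b m]|nout].
  have [zx by_ occ] := mv _ _ m (or_introl erefl).
  rewrite occ /exchange zx eqxx; by case/andP: occ => _ /negbTE.
case: asboolP => [[b m]|nin].
  have [bx zy occ] := mv _ _ m (or_intror erefl).
  rewrite occ /exchange zy eqxx; case/andP: occ => sx _.
  by case: eqP => // E; rewrite -?E in xy.
rewrite xiE//; case: ifPn => // occ; exfalso.
have m : moves K C s xi x y by split => //; rewrite !xiE//; [right|left].
by case: zxy => E; [apply: nout; exists y|apply: nin; exists x]; rewrite E.
Qed.

End graphical_construction.

(** * Integrals of functions that may fail to be measurable *)

Section integral_facts.
Context d (T : measurableType d) (R : realType) (P : probability T R).
Local Open Scope ereal_scope.

(** The integral of a non-negative function is a supremum over the simple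
    functions below it, hence monotone even without measurability. *)
Lemma le_integral_any (f g : T -> \bar R) : (forall x, f x <= g x) ->
  \int[P]_x f x <= \int[P]_x g x.
Proof.
move=> fg.
have ge0_le (a b : T -> \bar R) : (forall x, 0 <= a x) -> (forall x, a x <= b x) ->
    \int[P]_x a x <= \int[P]_x b x.
  move=> a0 ab; have b0 x : 0 <= b x := le_trans (a0 x) (ab x).
  rewrite !ge0_integralTE//; apply: le_ereal_sup => _ [h ha <-].
  by exists h => // x; exact: le_trans (ha x) (ab x).
rewrite [leLHS]integralE [leRHS]integralE; apply: leeB.
  apply: ge0_le => // x; rewrite !funeposE.
  by rewrite ge_max !le_max fg lexx orbT.
apply: ge0_le => // x; rewrite !funenegE.
by rewrite ge_max !le_max leeN2 fg lexx orbT.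
Qed.

Lemma measurable_esum (I : countType) (J : set I) (g : I -> T -> \bar R) :
  (forall i, measurable_fun setT (g i)) -> (forall i x, 0 <= g i x) ->
  measurable_fun setT (fun x => \esum_(i in J) g i x).
Proof.
move=> mg g0; rewrite (_ : (fun x => _) = (fun x => \sum_(n <oo)
    oapp (fun i => if i \in J then g i x else 0) 0 (@pickle_inv I n))); last first.
  by apply/funext => x; rewrite esum_pickle.
apply: (ge0_emeasurable_sum (P := xpredT)) => [n x _ _|n _].
  by case: pickle_inv => //= i; case: ifP.
case: pickle_inv => //= i.
by case: (i \in J).
Qed.

Lemma integral_esum (I : countType) (J : set I) (g : I -> T -> \bar R) :
  (forall i, measurable_fun setT (g i)) -> (forall i x, 0 <= g i x) ->
  \int[P]_x (\esum_(i in J) g i x) = \esum_(i in J) \int[P]_x g i x.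
Proof.
move=> mg g0; rewrite esum_pickle; last by move=> i; exact: integral_ge0.
under eq_integral do rewrite esum_pickle//.
rewrite integral_nneseries//.
- apply: eq_eseriesr => n _; case: pickle_inv => [i|] /=; last by rewrite integral0.
  by case: ifP => // _; rewrite integral0.
- by move=> n; case: pickle_inv => //= i; case: (i \in J).
- by move=> n x _; case: pickle_inv => //= i; case: ifP.
Qed.

Lemma integral_indic_scale (A : set T) (k : \bar R) : measurable A -> 0 <= k ->
  \int[P]_x ((\1_A x)%:E * k) = P A * k.
Proof.
move=> mA k0; rewrite ge0_integralZr//; first by rewrite integral_indic// setIT.
by apply/measurable_EFinP; exact: measurable_indic.
Qed.

Lemma measurable_indic_scale (A : set T) (k : \bar R) : measurable A ->
  measurable_fun setT (fun x => (\1_A x)%:E * k).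
Proof.
move=> mA; apply: emeasurable_funM; last exact: measurable_cst.
by apply/measurable_EFinP; exact: measurable_indic.
Qed.

Lemma indic_scale_ge0 (A : set T) (k : \bar R) x : 0 <= k -> 0 <= (\1_A x)%:E * k.
Proof. by move=> k0; rewrite mule_ge0 ?lee_fin. Qed.

(** The points outside some measurable null set belong to D, and there u lies
    between h - g and h + g; monotonicity of the integral for arbitrary functions
    concludes. *)
Lemma integral_squeeze (D : set T) (u h : T -> R) (g : T -> \bar R) :
  measurable_fun setT h -> P.-integrable setT (EFin \o h) ->
  measurable_fun setT g -> (forall x, 0 <= g x) -> \int[P]_x g x < +oo ->
  {ae P, forall x, D x /\ `|u x - h x|%R%:E <= g x} ->
  `|fine (\int[P]_(x in D) (u x)%:E) - fine (\int[P]_x (h x)%:E)|%R%:E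
    <= \int[P]_x g x.
Proof.
move=> mh ih mg g0 goo [N [mN PN0 NH]].
(* On N nothing is known about u, so the bound is made infinite there; this
   does not change its integral. *)
pose g' x := g x + (\1_N x)%:E * +oo.
have mg' : measurable_fun setT g'.
  by apply: emeasurable_funD => //; exact: measurable_indic_scale.
have g'0 x : 0 <= g' x by rewrite adde_ge0// indic_scale_ge0.
have Ig' : \int[P]_x g' x = \int[P]_x g x.
  rewrite ge0_integralD//; last exact: measurable_indic_scale.
  by rewrite integral_indic_scale// [P N]PN0 mul0e adde0.
have ig' : P.-integrable setT g'.
  apply/integrableP; split => //.
  by under eq_integral do rewrite gee0_abs//; rewrite Ig'.
have H x : ((h x)%:E - g' x <= (EFin \o u \_ D) x <= (h x)%:E + g' x).
  have [xN|xN] := pselect (N x).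
    have -> : g' x = +oo.
      rewrite /g' indicE mem_set// mul1e addey//.
      by rewrite gt_eqF// (lt_le_trans _ (g0 x))// ltNyr.
    by rewrite /= leNye leey.
  have -> : g' x = g x by rewrite /g' indicE memNset// mul0e adde0.
  have [Dx ux] : D x /\ `|u x - h x|%R%:E <= g x.
    by apply: contrapT => nH; apply: xN; apply: NH.
  rewrite /= patchT ?inE//.
  case: (g x) ux => [r| |]; [|by rewrite /= ?leNye ?leey|by rewrite leeNy_eq].
  by rewrite lee_fin ler_norml -EFinB -EFinD !lee_fin => /andP[h1 h2];
    apply/andP; split; lra.
rewrite integral_mkcond.
have -> : \int[P]_x ((fun x => (u x)%:E) \_ D) x = \int[P]_x (EFin \o u \_ D) x.
  by apply: eq_integral => x _; rewrite /= restrict_EFin.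
have lo := le_integral_any (fun x => proj1 (andP (H x))).
have hi := le_integral_any (fun x => proj2 (andP (H x))).
rewrite integralB// in lo; rewrite integralD// in hi.
rewrite Ig' in lo hi.
have gfin : \int[P]_x g x \is a fin_num by rewrite ge0_fin_numE// integral_ge0.
have hfin : \int[P]_x (EFin \o h) x \is a fin_num by exact: integrable_fin_num.
move: lo hi; rewrite -(fineK gfin) -(fineK hfin).
case: (\int[P]_x (EFin \o u \_ D) x) => [r| |].
- rewrite -EFinB -EFinD !lee_fin/= => h1 h2; rewrite ler_norml.
  by apply/andP; split; move: h1 h2; rewrite /comp; lra.
- by rewrite -EFinD leye_eq.
- by rewrite -EFinB leeNy_eq.
Qed.

End integral_facts.

(** * Short-time expansion of the semigroup *)

Section short_time_expansion.
Context {R : realType} {S : countType}.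
Variables (c : S -> S -> R) (c_ge0 : forall x y, 0 <= c x y).
Hypothesis c_diag : forall x, c x x = 0.
Variables (P : probability (path_space R S) R) (P_poisson : poisson_family c P).
Variables (t0 : R) (t0_gt0 : 0 < t0).
Hypothesis SEP : {ae P, forall K, finite_components t0 0 K}.
Variables (f : config S -> R) (f_cont : continuous f).
Hypothesis f_Delta : (\esum_(x in [set: S]) Delta f x < +oo)%E.
Hypothesis f_rate : (\esum_(x in [set: S]) (total_rate c x * Delta f x) < +oo)%E.
Implicit Types (sigma xi : config S) (p q : S * S) (K : path_space R S) (t : R).

Let W p : \bar R := (Delta f p.1 + Delta f p.2)%E.

Let W_ge0 p : (0 <= W p)%E.
Proof. by rewrite adde_ge0// Delta_ge0. Qed.

Let osc : R := fine (\esum_(x in [set: S]) Delta f x).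

Let osc_ge0 : 0 <= osc.
Proof. by rewrite fine_ge0// esum_ge0// => x _; exact: Delta_ge0. Qed.

Let osc_ub xi zeta : `|f xi - f zeta| <= osc.
Proof.
rewrite -lee_fin fineK; last first.
  by rewrite ge0_fin_numE// esum_ge0// => x _; exact: Delta_ge0.
apply: le_trans (diff_le_Delta xi zeta f_cont) _.
by apply: esum_subset => // x; exact: Delta_ge0.
Qed.

Let gain sigma p : R := f (attempt sigma p) - f sigma.

Let exclusion_termE sigma p :
  exclusion_term c f p.1 p.2 sigma = c p.1 p.2 * gain sigma p.
Proof.
rewrite /exclusion_term /gain /attempt.
case: (sigma p.1); case: (sigma p.2) => /=.
- by rewrite !(subrr, mulr0, mul0r).
- by rewrite subr0 !mulr1.
- by rewrite !(subrr, mulr0, mul0r).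
- by rewrite !(subrr, mulr0, mul0r).
Qed.

(** Each site of A is charged to one pair of Q that meets it; since a pair has
    two sites, the sum over pairs is read as a sum over sites of the number of
    pairs of Q that start or end there. *)
Lemma esum_Delta_covered (A : set S) (Q : set (S * S)) :
  (forall x, A x -> exists q, Q q /\ (q.1 = x \/ q.2 = x)) ->
  (\esum_(x in A) Delta f x <= \esum_(q in Q) W q)%E.
Proof.
move=> AQ.
have D0 := @Delta_ge0 R S f.
rewrite esum_mkcond [leRHS]esum_mkcond.
pose ind x y : \bar R := if (x, y) \in Q then 1%E else 0%E.
have ind0 x y : (0 <= ind x y)%E by rewrite /ind; case: ifP.
have iD0 x y : (0 <= ind x y * Delta f x)%E by rewrite mule_ge0.
have iD0' x y : (0 <= ind y x * Delta f x)%E by rewrite mule_ge0.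
rewrite (eq_esum (I := [set: S * S])
  (b := fun p => (ind p.1 p.2 * Delta f p.1 + ind p.1 p.2 * Delta f p.2)%E)); last first.
  move=> [x y] _; rewrite /ind /W /=; case: ifP => _; first by rewrite !mul1e.
  by rewrite !mul0e adde0.
rewrite esumD//.
rewrite (esum_pair_swap (fun x y => (ind x y * Delta f y)%E)) -esumD//.
rewrite (esum_pair (a := fun x y => (ind x y * Delta f x + ind y x * Delta f x)%E));
  last by move=> x y; rewrite adde_ge0.
apply: le_esum => x _; case: ifPn => [|_]; last by apply: esum_ge0 => y _; rewrite adde_ge0.
rewrite inE => /AQ[[a b] /= [Qab xab]].
case: xab => E; subst.
  apply: le_trans (esum_ge (x := (ind x b * Delta f x)%E) _); last first.
    exists [set b]; first by split.
    by rewrite fsbig_set1 leeDl.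
  by rewrite /ind mem_set// mul1e.
apply: le_trans (esum_ge (x := (ind a x * Delta f x)%E) _); last first.
  exists [set a]; first by split.
  by rewrite fsbig_set1 leeDr.
by rewrite /ind mem_set// mul1e.
Qed.

Section finite_pairs.
Variable F : {fset S * S}.

(** A second ringing pair in F spoils the expansion even if it is far from p,
    because f need not be additive over distant jumps. *)
Definition conflict p : set (S * S) := [set q | q <> p /\
  (q \in F \/ [\/ q.1 = p.1, q.2 = p.1, q.1 = p.2 | q.2 = p.2])].

Definition outer_touch t K : \bar R :=
  (\esum_(q in ~` [set` F]) ((\1_(rings 0 t q) K)%:E * W q))%E.

Definition conflict_count t K : \bar R := (\esum_(p in [set` F])
  ((\1_(rings_twice 0 t p) K)%:E +
   \esum_(q in conflict p) (\1_(rings 0 t p `&` rings 0 t q) K)%:E))%E.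

Definition one_jump sigma t K : R :=
  f sigma + \sum_(p <- F) \1_(rings 0 t p) K * gain sigma p.

(** Trivial bound for the distance between f (eta_t) and [one_jump]: the
    variation of f, once for f (eta_t) and once for each pair of F. *)
Definition error_scale : R := osc + #|` F|%:R * osc.

Let error_scale_ge0 : 0 <= error_scale.
Proof. by rewrite addr_ge0// mulr_ge0. Qed.

Let indic_ge0 (A : set (path_space R S)) K : (0 <= (\1_A K)%:E :> \bar R)%E.
Proof. by rewrite lee_fin. Qed.

Let conflict_term_ge0 t K p : (0 <= (\1_(rings_twice 0 t p) K)%:E +
   \esum_(q in conflict p) (\1_(rings 0 t p `&` rings 0 t q) K)%:E :> \bar R)%E.
Proof. by rewrite adde_ge0// esum_ge0. Qed.

Let outer_touch_ge0 t K : (0 <= outer_touch t K)%E.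
Proof. by apply: esum_ge0 => q _; exact: indic_scale_ge0. Qed.

Let conflict_count_ge0 t K : (0 <= conflict_count t K)%E.
Proof. by apply: esum_ge0 => p _. Qed.

Let outer_touch_ub t K xi zeta :
  (forall z, xi z != zeta z ->
     exists q, [/\ q \notin F, rings 0 t q K & q.1 = z \/ q.2 = z]) ->
  (`|f xi - f zeta|%:E <= outer_touch t K)%E.
Proof.
move=> H; apply: le_trans (diff_le_Delta xi zeta f_cont) _.
apply: (@le_trans _ _ (\esum_(q in [set q | q \notin F /\ rings 0 t q K]) W q)%E).
  apply: esum_Delta_covered => z /H[q [qF rq qz]]; by exists q.
apply: (@le_trans _ _ (\esum_(q in [set q | q \notin F /\ rings 0 t q K])
    ((\1_(rings 0 t q) K)%:E * W q))%E).
  by apply: le_esum => q [_ rq]; rewrite indicE mem_set// mul1e.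
apply: esum_subset => [q|q [qF _] /=]; first exact: indic_scale_ge0.
exact/negP.
Qed.

Let conflict_count_ge1 t K p : p \in F ->
  rings_twice 0 t p K \/ (exists2 q, conflict p q & rings 0 t p K /\ rings 0 t q K) ->
  (1 <= conflict_count t K)%E.
Proof.
move=> pF bad; rewrite /conflict_count.
apply: le_trans (esum_ge (x := ((\1_(rings_twice 0 t p) K)%:E +
   \esum_(q in conflict p) (\1_(rings 0 t p `&` rings 0 t q) K)%:E)%E) _); last first.
  exists [set p]; first by split => // _ ->.
  by rewrite fsbig_set1.
case: bad => [tw|[q pq rr]].
  by rewrite indicE mem_set// leeDl// esum_ge0.
apply: le_trans (leeDr _ _); last by [].
apply: esum_ge; exists [set q]; first by split => // _ ->.
by rewrite fsbig_set1 indicE mem_set.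
Qed.

(** When no pair of F is involved in a conflict, at most one of them rings, and
    it acts as an isolated jump; any other discrepancy with the initial
    configuration is at sites touched by pairs outside F. *)
Lemma eta_one_jump t K sigma : 0 < t -> t < t0 -> Gamma_star t0 K ->
  nondecreasing_paths K ->
  (`|f (Defs.eta t0 K sigma t) - one_jump sigma t K|%:E <=
   outer_touch t K + error_scale%:E * conflict_count t K)%E.
Proof.
move=> t_gt0 t_lt KG Knd; set et := Defs.eta t0 K sigma t.
have [[p pF bad]|nobad] := pselect (exists2 p, p \in F & rings_twice 0 t p K \/
    (exists2 q, conflict p q & rings 0 t p K /\ rings 0 t q K)).
  (* A conflict is counted at least once, so the trivial bound suffices. *)
  apply: (@le_trans _ _ error_scale%:E); last first.
    apply: (@le_trans _ _ (error_scale%:E * conflict_count t K)%E); last by rewrite leeDr.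
    by rewrite -[leLHS]mule1 lee_wpmul2l ?lee_fin// (conflict_count_ge1 pF bad).
  rewrite lee_fin /one_jump opprD addrA (le_trans (ler_normB _ _))// lerD//.
  rewrite (le_trans (ler_norm_sum _ _ _))//.
  rewrite (le_trans (ler_sum (G := fun=> osc) _ _))//.
    move=> q _; rewrite normrM (le_trans _ (osc_ub (attempt sigma q) sigma))//.
    by rewrite ler_piMl// indicE; case: (_ \in _); rewrite ?normr1 ?normr0.
  rewrite big_const_seq count_predT iter_addr_0 mulr_natl; exact: lexx.
apply: le_trans (leeDl _ _); last by rewrite mule_ge0 ?lee_fin.
have noconf p q : p \in F -> rings 0 t p K -> rings 0 t q K -> conflict p q -> False.
  by move=> pF rp rq pq; apply: nobad; exists p => //; right; exists q.
have [[p pF rp]|nring] := pselect (exists2 p, p \in F & rings 0 t p K); last first.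
  rewrite /one_jump big_seq big1 ?addr0; last first.
    move=> q qF; rewrite indicE memNset ?mul0r// => rq.
    by apply: nring; exists q.
  apply: outer_touch_ub => z; apply: contraNP => nq; apply/eqP.
  apply: (eta_untouched t0_gt0 t_gt0 t_lt KG Knd) => q qz rq; apply: nq.
  exists q; split => //; apply/negP => qF; apply: nring; by exists q.
(* The other pairs of F are silent, otherwise they would conflict with p. *)
have oneE : one_jump sigma t K = f (attempt sigma p).
  rewrite /one_jump (big_fsetD1 p)//= indicE mem_set// mul1r.
  rewrite big_seq big1 ?addr0; first by rewrite /gain addrC subrK.
  move=> q; rewrite !inE => /andP[qp qF]; rewrite indicE memNset ?mul0r// => rq.
  by apply: (noconf p q) => //; split; [exact/eqP|left].
rewrite oneE; apply: outer_touch_ub => z hz.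
case: p => x y in pF rp oneE hz *.
have xy : x <> y by move=> E; move: rp; rewrite E rings_diag.
have single := eta_single t0_gt0 t_gt0 t_lt KG Knd sigma xy rp.
have {}single u : u = x \/ u = y -> et u = attempt sigma (x, y) u.
  apply: single => [tw|q qxy touch rq]; first by apply: nobad; exists (x, y) => //; left.
  by apply: (noconf (x, y) q) => //; split => //; right; case: touch => ->; constructor.
have zx : z <> x by move=> E; move: hz; rewrite single ?eqxx//; left.
have zy : z <> y by move=> E; move: hz; rewrite single ?eqxx//; right.
apply: contrapT => nq; move/negP : hz; apply; apply/eqP.
have -> : attempt sigma (x, y) z = sigma z.
  rewrite /attempt /=; case: ifP => // _; rewrite /exchange.
  by case: eqP => // _; case: eqP.
apply: (eta_untouched t0_gt0 t_gt0 t_lt KG Knd) => q qz rq; apply: nq.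
exists q; split => //; apply/negP => qF; apply: (noconf (x, y) q) => //.
split; last by left.
by move=> E; case: qz; rewrite E => /esym.
Qed.

Definition outer_rate : \bar R := (\esum_(q in ~` [set` F]) term_bound c f q.1 q.2)%E.

Definition conflict_rate : \bar R := (\esum_(p in [set` F])
  ((c p.1 p.2 ^+ 2)%:E + \esum_(q in conflict p) (c p.1 p.2 * c q.1 q.2)%:E))%E.

Let measurable_outer_touch t : 0 < t -> measurable_fun setT (outer_touch t).
Proof.
move=> t_gt0; apply: measurable_esum => [q|q K]; last exact: indic_scale_ge0.
by apply: measurable_indic_scale; apply: measurable_rings => //; exact: ltW.
Qed.

Let measurable_indicE (A : set (path_space R S)) : measurable A ->
  measurable_fun setT (fun K => (\1_A K)%:E : \bar R).
Proof. by move=> mA; apply/measurable_EFinP; exact: measurable_indic. Qed.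

Let measurable_conflict_term t p : 0 < t ->
  measurable_fun setT (fun K => (\1_(rings_twice 0 t p) K)%:E +
   \esum_(q in conflict p) (\1_(rings 0 t p `&` rings 0 t q) K)%:E : \bar R)%E.
Proof.
move=> /ltW t_ge0; apply: emeasurable_funD.
  by apply: measurable_indicE; exact: measurable_rings_twice.
apply: measurable_esum => // q; apply: measurable_indicE.
by apply: measurableI; exact: measurable_rings.
Qed.

Let measurable_conflict_count t : 0 < t -> measurable_fun setT (conflict_count t).
Proof.
by move=> t_gt0; apply: measurable_esum => // p; exact: measurable_conflict_term.
Qed.

Let integral_outer_touch t : 0 < t ->
  (\int[P]_K outer_touch t K <= outer_rate * t%:E)%E.
Proof.
move=> t_gt0; have t_ge0 := ltW t_gt0; rewrite integral_esum; last 2 first.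
- move=> q; apply: measurable_indic_scale; exact: measurable_rings.
- by move=> q K; exact: indic_scale_ge0.
apply: le_trans (esum_wpM2r _ _ _); last 2 first.
- by move=> q; exact: term_bound_ge0.
- by rewrite lee_fin.
apply: le_esum => q _; rewrite integral_indic_scale//; last exact: measurable_rings.
rewrite /term_bound muleAC lee_wpmul2r//.
by have := P_rings_le c_ge0 c_diag P_poisson q (lexx 0) t_ge0; rewrite subr0 EFinM.
Qed.

Let integral_conflict_count t : 0 < t ->
  (\int[P]_K conflict_count t K <= conflict_rate * (t ^+ 2)%:E)%E.
Proof.
move=> t_gt0; have t_ge0 := ltW t_gt0; rewrite integral_esum//; last first.
  by move=> p; exact: measurable_conflict_term.
apply: le_trans (esum_wpM2r _ _ _); last 2 first.
- move=> p; rewrite adde_ge0 ?lee_fin ?sqr_ge0// esum_ge0// => q _.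
  by rewrite lee_fin mulr_ge0.
- by rewrite lee_fin sqr_ge0.
apply: le_esum => p _; rewrite ge0_integralD//; last 3 first.
- by apply: measurable_indicE; exact: measurable_rings_twice.
- by move=> K _; rewrite esum_ge0.
- apply: measurable_esum => // q; apply: measurable_indicE.
  by apply: measurableI; exact: measurable_rings.
rewrite ge0_muleDl ?lee_fin ?sqr_ge0 ?esum_ge0//; last first.
  by move=> q _; rewrite lee_fin mulr_ge0.
apply: leeD.
  rewrite integral_indic// ?setIT; last exact: measurable_rings_twice.
  rewrite (le_trans (P_rings_twice_le c_ge0 P_poisson _ _ _))//.
  by rewrite subr0 -EFinM exprMn.
rewrite integral_esum//; last first.
  by move=> q; apply: measurable_indicE; apply: measurableI; exact: measurable_rings.
apply: le_trans (esum_wpM2r _ _ _); last 2 first.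
- by move=> q; rewrite lee_fin mulr_ge0.
- by rewrite lee_fin sqr_ge0.
apply: le_esum => q [qp _]; rewrite integral_indic// ?setIT; last first.
  by apply: measurableI; exact: measurable_rings.
have pq : p <> q by exact/nesym.
rewrite (le_trans (P_rings2_le c_ge0 P_poisson pq _ t_ge0))//.
by rewrite subr0 -EFinM lee_fin expr2 mulrACA.
Qed.

Let esum_incident x :
  (\esum_(q in [set q : S * S | q.1 = x \/ q.2 = x]) (c q.1 q.2)%:E < +oo)%E.
Proof.
have tot := total_rate_fin c_ge0 P_poisson t0_gt0 SEP x.
have c0 (q : S * S) : (0 <= (c q.1 q.2)%:E)%E by rewrite lee_fin.
rewrite (esumID [set q : S * S | q.1 = x])//.
apply: lte_add_pinfty.
  apply: le_lt_trans tot.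
  apply: (@le_trans _ _ (\esum_(q in [set (x, y) | y in [set: S]]) (c q.1 q.2)%:E)%E).
    by apply: esum_subset => // -[a b] /= [_ ->]; exists b.
  rewrite esum_image; last by move=> y y' _ _ [].
  by apply: le_esum => y _; rewrite lee_fin lerDl.
apply: le_lt_trans tot.
apply: (@le_trans _ _ (\esum_(q in [set (y, x) | y in [set: S]]) (c q.1 q.2)%:E)%E).
  by apply: esum_subset => // -[a b] /= [[ax|->] nax]; [exfalso; exact: nax|exists a].
rewrite esum_image; last by move=> y y' _ _ [].
by apply: le_esum => y _; rewrite lee_fin lerDr.
Qed.

Let esum_setU_le (A B : set (S * S)) (a : S * S -> \bar R) : (forall q, 0 <= a q)%E ->
  (\esum_(q in A `|` B) a q <= \esum_(q in A) a q + \esum_(q in B) a q)%E.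
Proof.
move=> a0; rewrite (esumID A)//; apply: leeD; apply: esum_subset => //.
by move=> q [[//|Bq] nA].
Qed.

Let conflict_rate_fin : (conflict_rate < +oo)%E.
Proof.
have c0 (q : S * S) : (0 <= (c q.1 q.2)%:E)%E by rewrite lee_fin.
have t_ge0 p : (0 <= (c p.1 p.2 ^+ 2)%:E +
    \esum_(q in conflict p) (c p.1 p.2 * c q.1 q.2)%:E)%E.
  rewrite adde_ge0 ?lee_fin ?sqr_ge0// esum_ge0// => q _.
  by rewrite lee_fin mulr_ge0.
rewrite /conflict_rate esum_fsetE//.
apply/lte_sum_pinfty => p _; apply: lte_add_pinfty; first by rewrite ltry.
apply: (@le_lt_trans _ _ ((\esum_(q in conflict p) (c q.1 q.2)%:E) * (c p.1 p.2)%:E)%E).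
  apply: le_trans (esum_wpM2r _ _ _) => //.
  by apply: le_esum => q _; rewrite -EFinM mulrC.
have s0 (A : set (S * S)) : (0 <= \esum_(q in A) (c q.1 q.2)%:E)%E by exact: esum_ge0.
rewrite muleC; apply: lte_mul_pinfty; rewrite ?lee_fin//.
apply: (@le_lt_trans _ _ (\esum_(q in [set` F] `|`
   ([set q | q.1 = p.1 \/ q.2 = p.1] `|` [set q | q.1 = p.2 \/ q.2 = p.2])) (c q.1 q.2)%:E)%E).
  apply: esum_subset => // q [_ [qF|[H|H|H|H]]]; first by left.
  - by right; left; left.
  - by right; left; right.
  - by right; right; left.
  - by right; right; right.
apply: le_lt_trans (esum_setU_le _ _ c0) _; apply: lte_add_pinfty.
  by rewrite esum_fsetE// sumEFin ltry.
apply: le_lt_trans (esum_setU_le _ _ c0) _.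
by apply: lte_add_pinfty; exact: esum_incident.
Qed.

Let outer_rate_fin : (outer_rate < +oo)%E.
Proof.
apply: le_lt_trans (term_bound_summable c_ge0 f_rate).
by apply: esum_subset => // q; exact: term_bound_ge0.
Qed.

Let outer_rate_ge0 : (0 <= outer_rate)%E.
Proof. by apply: esum_ge0 => q _; exact: term_bound_ge0. Qed.

Let conflict_rate_ge0 : (0 <= conflict_rate)%E.
Proof.
apply: esum_ge0 => p _; rewrite adde_ge0 ?lee_fin ?sqr_ge0// esum_ge0// => q _.
by rewrite lee_fin mulr_ge0.
Qed.

Let integrable_indicM (A : set (path_space R S)) (k : R) : measurable A ->
  P.-integrable setT (EFin \o (fun K => \1_A K * k)).
Proof.
move=> mA; apply: (@measurable_bounded_integrable _ _ _ P) => //.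
- by rewrite (le_lt_trans (probability_le1 _ _))// ltry.
- by apply: measurable_funM; [exact: measurable_indic|exact: measurable_cst].
exists `|k|; split; first exact: num_real.
move=> M kM K _ /=; rewrite normrM (le_trans _ (ltW kM))// ler_piMl//.
by rewrite indicE; case: (_ \in _); rewrite ?normr1 ?normr0.
Qed.

Let integral_indicM (A : set (path_space R S)) (k : R) : measurable A ->
  (\int[P]_K (\1_A K * k)%:E = P A * k%:E)%E.
Proof.
move=> mA; under eq_integral do rewrite EFinM.
rewrite integralZr//; first by rewrite integral_indic// setIT.
have := integrable_indicM 1 mA; apply: eq_integrable => // K _ /=.
by rewrite mulr1.
Qed.

Let one_jump_sum sigma t := \sum_(p <- F) (1 - expR (- (c p.1 p.2 * t))) * gain sigma p.

Let integrable_one_jump sigma t : 0 < t ->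
  P.-integrable setT (EFin \o one_jump sigma t) /\
  (\int[P]_K (one_jump sigma t K)%:E = (f sigma + one_jump_sum sigma t)%:E)%E.
Proof.
move=> t_gt0; have t_ge0 := ltW t_gt0.
have mr p := measurable_rings p (lexx 0) t_ge0.
have ic : P.-integrable setT (fun=> (f sigma)%:E).
  exact: (finite_measure_integrable_cst P).
have Ic : (\int[P]_(K in setT) (f sigma)%:E = (f sigma)%:E)%E.
  by rewrite integral_cst// [X in (_ * X)%E]probability_setT mule1.
have is_ : P.-integrable setT
    (fun K => \sum_(p <- F) (\1_(rings 0 t p) K * gain sigma p)%:E)%E.
  by apply: integrable_sum => // p _; exact: integrable_indicM.
have E : EFin \o one_jump sigma t =
   ((fun=> (f sigma)%:E) \+ (fun K => \sum_(p <- F) (\1_(rings 0 t p) K * gain sigma p)%:E))%E.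
  by apply/funext => K; rewrite /= /one_jump EFinD sumEFin.
split; first by rewrite E; exact: integrableD.
rewrite -[X in (\int[P]_K X K)%E]/(EFin \o one_jump sigma t) E integralD//.
rewrite Ic integral_sum//; last first.
  by move=> p; exact: integrable_indicM.
rewrite EFinD -sumEFin; congr (_ + _)%E; apply: eq_bigr => p _.
by rewrite integral_indicM// (P_rings c_ge0 c_diag P_poisson)// subr0.
Qed.

(** The error in [eta_one_jump] is a countable combination of indicators of
    events that some pair rings, rings twice, or that two pairs ring: its mean is
    read off from the probabilities of these events. *)
Lemma semigroup_one_jump sigma t : 0 < t -> t < t0 ->
  `|semigroup P t0 t f sigma - (f sigma + one_jump_sum sigma t)| <=
  fine outer_rate * t + error_scale * fine conflict_rate * t ^+ 2.
Proof.
move=> t_gt0 t_lt; have [io Eo] := integrable_one_jump sigma t_gt0.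
pose g K := (outer_touch t K + error_scale%:E * conflict_count t K)%E.
have mo := measurable_outer_touch t_gt0; have mc := measurable_conflict_count t_gt0.
have mec : measurable_fun setT (fun K => error_scale%:E * conflict_count t K)%E.
  by apply: emeasurable_funM => //; exact: measurable_cst.
have Ig : (\int[P]_K g K <= (fine outer_rate * t +
    error_scale * fine conflict_rate * t ^+ 2)%:E)%E.
  rewrite /g ge0_integralD//; last by move=> K _; rewrite mule_ge0 ?lee_fin.
  have I1 : (\int[P]_K outer_touch t K <= (fine outer_rate * t)%:E)%E.
    by rewrite EFinM fineK ?ge0_fin_numE// integral_outer_touch.
  have I2 : (\int[P]_K (error_scale%:E * conflict_count t K) <=
      (error_scale * fine conflict_rate * t ^+ 2)%:E)%E.
    rewrite ge0_integralZl// ?lee_fin// -mulrA EFinM lee_wpmul2l ?lee_fin//.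
    by rewrite EFinM fineK ?ge0_fin_numE// integral_conflict_count.
  by rewrite (le_trans (leeD I1 I2)).
rewrite -lee_fin (le_trans _ Ig)//.
have -> : f sigma + one_jump_sum sigma t = fine (\int[P]_K (one_jump sigma t K)%:E)%E.
  by rewrite Eo.
apply: integral_squeeze => //.
- by move/integrableP : io => [/measurable_EFinP].
- by apply: emeasurable_funD.
- by move=> K; rewrite adde_ge0// mule_ge0 ?lee_fin.
- by rewrite (le_lt_trans Ig)// ltry.
apply: (ae_imply2 _ (ae_Gamma_star c_ge0 P_poisson t0_gt0 SEP c_diag)
  (ae_Gamma_star c_ge0 P_poisson t0_gt0 SEP c_diag)) => K [KG Knd] _.
by split => //; exact: eta_one_jump.
Qed.

Let L := exclusion_sum c f.

Definition quadratic_error : R :=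
  error_scale * fine conflict_rate + \sum_(p <- F) c p.1 p.2 ^+ 2 * osc.

(** The outer rate enters twice: for the trajectories, and for the truncation of
    the generator series to F. The replacement of the ringing probabilities
    1 - exp (- c t) by c t costs O(t^2). *)
Lemma quotient_bound sigma t : 0 < t -> t < t0 ->
  `|(semigroup P t0 t f sigma - f sigma) / t - L sigma| <=
  2 * fine outer_rate + quadratic_error * t.
Proof.
move=> t_gt0 t_lt; have t_ge0 := ltW t_gt0; have h1 := semigroup_one_jump sigma t_gt0 t_lt.
have h2 : `|\sum_(p <- F) c p.1 p.2 * gain sigma p - L sigma| <= fine outer_rate.
  rewrite -lee_fin fineK ?ge0_fin_numE//.
  under eq_bigr do rewrite -exclusion_termE.
  exact: exclusion_sum_approx.
have h3 : `|one_jump_sum sigma t - t * \sum_(p <- F) c p.1 p.2 * gain sigma p| <=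
    (\sum_(p <- F) c p.1 p.2 ^+ 2 * osc) * t ^+ 2.
  rewrite mulr_sumr -sumrB (le_trans (ler_norm_sum _ _ _))// mulr_suml ler_sum// => p _.
  have -> : (1 - expR (- (c p.1 p.2 * t))) * gain sigma p - t * (c p.1 p.2 * gain sigma p) =
    (1 - expR (- (c p.1 p.2 * t)) - c p.1 p.2 * t) * gain sigma p by ring.
  have -> : c p.1 p.2 ^+ 2 * osc * t ^+ 2 = (c p.1 p.2 * t) ^+ 2 * osc by ring.
  rewrite normrM ler_pM//; last exact: osc_ub.
  rewrite ler_norml.
  have r0 : 0 <= c p.1 p.2 * t by rewrite mulr_ge0.
  have := hit_prob_le (c p.1 p.2 * t); have := hit_prob_ge r0.
  have := sqr_ge0 (c p.1 p.2 * t).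
  by move=> a1 a2 a3; apply/andP; split; lra.
have tinv : t * t^-1 = 1 by rewrite mulfV// gt_eqF.
have -> : (semigroup P t0 t f sigma - f sigma) / t - L sigma =
  (semigroup P t0 t f sigma - (f sigma + one_jump_sum sigma t)) / t +
  ((one_jump_sum sigma t - t * \sum_(p <- F) c p.1 p.2 * gain sigma p) / t +
   (\sum_(p <- F) c p.1 p.2 * gain sigma p - L sigma)).
  by field; rewrite gt_eqF.
rewrite (le_trans (ler_normD _ _))//.
rewrite (le_trans (lerD (lexx _) (ler_normD _ _)))//.
rewrite !normrM !(ger0_norm (x := t^-1)) ?invr_ge0//.
have k1 := ler_wpM2r (x := t^-1) _ h1; have k3 := ler_wpM2r (x := t^-1) _ h3.
rewrite !invr_ge0 in k1 k3; have {}k1 := k1 t_ge0; have {}k3 := k3 t_ge0.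
apply: le_trans (lerD k1 (lerD k3 h2)) _.
rewrite /quadratic_error le_eqVlt; apply/orP; left; apply/eqP.
by field; rewrite gt_eqF.
Qed.

Lemma quadratic_error_ge0 : 0 <= quadratic_error.
Proof.
rewrite addr_ge0// ?mulr_ge0 ?fine_ge0// sumr_ge0// => p _.
by rewrite mulr_ge0// sqr_ge0.
Qed.

End finite_pairs.

Lemma generator_limit_exclusion_sum :
  generator_limit P t0 f (exclusion_sum c f).
Proof.
split => //; first exact: exclusion_sum_continuous.
apply: cvge_to0 => [t|e e0]; first exact: unorm_ge0.
(* Half of e is left to the two occurrences of the outer rate, half to t. *)
have e4 : 0 < e / 4 by rewrite divr_gt0.
have tb0 (q : S * S) : (0 <= term_bound c f q.1 q.2)%E by exact: term_bound_ge0.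
have [F Fe] := esum_tail tb0 (term_bound_summable c_ge0 f_rate) e4.
have ofin : fine (outer_rate F) <= e / 4.
  rewrite -lee_fin fineK ?ltW//.
  by rewrite ge0_fin_numE ?esum_ge0// (lt_trans Fe)// ltry.
have Q0 := quadratic_error_ge0 F.
near=> t.
have t_gt0 : 0 < t by near: t; exact: nbhs_right_gt.
have t_lt : t < t0 by near: t; exact: nbhs_right_lt.
have tQ : t < e / (2 * (quadratic_error F + 1)).
  near: t; apply: nbhs_right_lt; rewrite divr_gt0// mulr_gt0// ltr_pwDr//.
apply: unorm_le => sigma; rewrite lee_fin (le_trans (quotient_bound F sigma t_gt0 t_lt))//.
move: tQ; rewrite ltr_pdivlMr ?mulr_gt0 ?ltr_pwDr// => tQ.
nra.
Unshelve. all: by end_near. Qed.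

End short_time_expansion.

Theorem proposition5p12 (R : realType) (S : countType)
    (S_infinite : infinite_set [set: S])
    (c : S -> S -> R)
    (c_ge0 : forall x y, 0 <= c x y)
    (c_diag : forall x, c x x = 0)
    (P : probability (path_space R S) R)
    (P_poisson : poisson_family c P)
    (t0 : R) (t0_gt0 : 0 < t0)
    (SEP : {ae P, forall K, finite_components t0 0 K})
    (f : config S -> R)
    (f_cont : continuous f)
    (f_Delta : (\esum_(x in [set: S]) Delta f x < +oo)%E)
    (f_rate : (\esum_(x in [set: S]) (total_rate c x * Delta f x) < +oo)%E) :
  [/\ generator_domain P t0 f,
      absolutely_convergent (fun p : S * S => exclusion_term c f p.1 p.2) &
      generator P t0 f =
        series_sum (fun x => series_sum (fun y => exclusion_term c f x y))].
Proof.
have lim := generator_limit_exclusion_sum c_ge0 c_diag P_poisson t0_gt0 SEP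
  f_cont f_Delta f_rate.
split.
- by exists (exclusion_sum c f).
- exact: exclusion_term_summable.
- by rewrite (generator_limitE lim) series_sum_exclusion.
Qed.
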